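(* Let $\Delta$ be a simplicial complex on the vertex set $X=\{x_1,\dots,x_n\}$. Then for every integer $i$ with $-1\le i<\dim\Delta$, the ideal $I_{\Delta^i}$ has a degree resolution and $\operatorname{reg}\mathbb{K}[\Delta^i]=\dim\mathbb{K}[\Delta^i]$.
   Context: Let $n>0$, $X=\{x_1,\dots,x_n\}$, $\mathbb{K}$ a field and $R=\mathbb{K}[x_1,\dots,x_n]$. A simplicial complex $\Delta$ on $X$ is a collection of subsets of $X$ (called faces), closed under taking subsets and containing every singleton $\{x_i\}$. A face $F$ has dimension $|F|-1$, and $\dim\Delta$ is the maximum dimension of a face. The $i$-skeleton $\Delta^i$ is the subcomplex of all faces of $\Delta$ of dimension at most $i$ (so $\Delta^{-1}=\{\emptyset\}$). It is always regarded as a complex on the same set $X$, so that its non-faces are subsets of $X$. The Stanley-Reisner ideal $I_{\Delta^i}\subseteq R$ is generated by the monomials $\prod_{x_l\in N}x_l$ with $N\subseteq X$ a minimal non-face of $\Delta^i$, and $\mathbb{K}[\Delta^i]=R/I_{\Delta^i}$. The dimension $\dim\mathbb{K}[\Delta^i]$ is the Krull dimension. For a nonzero monomial ideal $I$, $\omega(I)$ is the maximum degree of a minimal monomial generator of $I$. The number $\beta_{a,b}(M)$ is the number of minimal generators of degree $b$ in homological position $a$ of the minimal graded free resolution of $M$ over $R$, and $\operatorname{reg}M=\max\{b-a\mid\beta_{a,b}(M)\ne0\}$. A monomial ideal $I\subseteq R$ has a degree resolution if $\beta_{a,b}(I)=0$ for all $a\ge0$ and $b>a+\omega(I)$; equivalently,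 $\operatorname{reg}I=\omega(I)$. *)

(* Defs.v *)
From HB Require Import structures.
From mathcomp Require Import all_boot all_order all_algebra.
From mathcomp Require Import boolp.
From mathcomp.multinomials Require Import mpoly.

Set Implicit Arguments.
Unset Strict Implicit.
Unset Printing Implicit Defensive.

Import Order.TTheory GRing.Theory Num.Theory.
Local Open Scope ring_scope.
Local Open Scope quotient_scope.

(* The vertex x_l is encoded by l : 'I_n. Singletons need not be faces: this is
   required only of a [simplicial_complex], whose skeleta of any dimension >= -1
   are again complexes on the same n vertices. *)
Record complex_on (n : nat) := ComplexOn {
  faces :> {set {set 'I_n}};
  face0 : set0 \in faces;
  face_subset : forall F G : {set 'I_n},
    G \subset F -> F \in faces -> G \in faces
}.

Record simplicial_complex (n : nat) := SimplicialComplex {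
  underlying_complex :> complex_on n;
  vertex_face : forall v : 'I_n, [set v] \in faces underlying_complex
}.

Definition face_dim (n : nat) (F : {set 'I_n}) : int := #|F|%:Z - 1.

(* The default -1 is the dimension of the empty face, which is always present. *)
Definition complex_dim (n : nat) (D : complex_on n) : int :=
  \big[Order.max/(-1)]_(F in faces D) face_dim F.

Section Skeleton.
Variables (n : nat) (D : complex_on n) (i : int) (hi : -1 <= i).

Definition skeleton_faces : {set {set 'I_n}} :=
  [set F in faces D | face_dim F <= i].

Lemma skeleton_face0 : set0 \in skeleton_faces.
Proof. by rewrite inE face0 /face_dim cards0 sub0r. Qed.

Lemma skeleton_face_subset (F G : {set 'I_n}) :
  G \subset F -> F \in skeleton_faces -> G \in skeleton_faces.
Proof.
move=> sGF; rewrite !inE => /andP[FD Fi].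
rewrite (face_subset sGF FD) /=; apply: le_trans Fi.
by rewrite lerD2r lez_nat subset_leq_card.
Qed.

Definition skeleton : complex_on n :=
  ComplexOn skeleton_face0 skeleton_face_subset.

End Skeleton.

Definition minimal_nonface (n : nat) (D : complex_on n) (N : {set 'I_n}) : bool :=
  minset (fun A => A \notin faces D) N.

Section StanleyReisner.
Variables (K : fieldType) (n : nat) (D : complex_on n).
Local Notation R := {mpoly K[n]}.

Definition SR_ideal : R -> bool := fun p =>
  `[< exists c : {set 'I_n} -> R,
        p = \sum_(N | minimal_nonface D N) c N * \prod_(l in N) 'X_l >].

Lemma SR_ideal_closed : @idealr_closed R SR_ideal.
Proof.
split.
- apply/asboolP; exists (fun=> 0).
  by rewrite big1 // => N _; rewrite mul0r.
- apply/negP => /asboolP [c] /(congr1 (meval (fun=> 0))).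
  rewrite meval1 raddf_sum big1 => [/eqP|N /minsetp ND].
    by rewrite oner_eq0.
  have /set0Pn [l lN] : N != set0.
    by apply: contraNneq ND => ->; apply: face0.
  by rewrite /= mevalM rmorph_prod (bigD1 l) //= mevalXU mul0r mulr0.
move=> a p q /asboolP [c ->] /asboolP [e ->].
apply/asboolP; exists (fun N => a * c N + e N).
rewrite mulr_sumr -big_split /=; apply: eq_bigr => N _.
by rewrite mulrDl mulrA.
Qed.

HB.instance Definition _ := isIdealr.Build R SR_ideal SR_ideal_closed.

Definition SR_idealr : idealr R := SR_ideal.

Definition stanley_reisner_ring : comNzRingType := {ideal_quot SR_idealr}.

End StanleyReisner.

Arguments SR_ideal K {n} D _.
Arguments SR_idealr K {n} D.
Arguments stanley_reisner_ring K {n} D.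

Section IdealModules.
Variables (R : comNzRingType) (I : idealr R).

Record ideal_module := IdealModule {
  ideal_val : R;
  ideal_valP : ideal_val \in (I : {pred R})
}.

HB.instance Definition _ := [isSub for ideal_val].
HB.instance Definition _ := [Choice of ideal_module by <:].
HB.instance Definition _ := [SubChoice_isSubZmodule of ideal_module by <:].

Definition ideal_scale (r : R) (x : ideal_module) : ideal_module :=
  IdealModule (@idealMr R I r _ (ideal_valP x)).

Lemma ideal_scaleA a b x :
  ideal_scale a (ideal_scale b x) = ideal_scale (a * b) x.
Proof. by apply: val_inj; rewrite /= mulrA. Qed.

Lemma ideal_scale1 : left_id 1 ideal_scale.
Proof. by move=> x; apply: val_inj; rewrite /= mul1r. Qed.

Lemma ideal_scaleDr : right_distributive ideal_scale +%R.
Proof. by move=> a x y; apply: val_inj; rewrite /= mulrDr. Qed.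

Lemma ideal_scaleDl x : {morph ideal_scale^~ x : a b / a + b}.
Proof. by move=> a b; apply: val_inj; rewrite /= mulrDl. Qed.

HB.instance Definition _ := GRing.Zmodule_isLmodule.Build R ideal_module
  ideal_scaleA ideal_scale1 ideal_scaleDr ideal_scaleDl.

Definition quot_scale (r : R) (x : {ideal_quot I}) : {ideal_quot I} :=
  \pi r * x.

Lemma quot_scaleA a b x :
  quot_scale a (quot_scale b x) = quot_scale (a * b) x.
Proof. by rewrite /quot_scale mulrA -rmorphM. Qed.

Lemma quot_scale1 : left_id 1 quot_scale.
Proof. by move=> x; rewrite /quot_scale rmorph1 mul1r. Qed.

Lemma quot_scaleDr : right_distributive quot_scale +%R.
Proof. by move=> a x y; rewrite /quot_scale mulrDr. Qed.

Lemma quot_scaleDl x : {morph quot_scale^~ x : a b / a + b}.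
Proof. by move=> a b; rewrite /quot_scale rmorphD mulrDl. Qed.

HB.instance Definition _ := GRing.Zmodule_isLmodule.Build R {ideal_quot I}
  quot_scaleA quot_scale1 quot_scaleDr quot_scaleDl.

End IdealModules.

Section Gradings.
Variables (K : fieldType) (n : nat) (I : idealr {mpoly K[n]}).

Definition ideal_homog (d : nat) (x : ideal_module I) : Prop :=
  ideal_val x \is d.-homog.

Definition quot_homog (d : nat) (x : {ideal_quot I}) : Prop :=
  exists2 p : {mpoly K[n]}, p \is d.-homog & x = \pi p.

End Gradings.

Section Resolutions.
Variables (K : fieldType) (n : nat).
Local Notation R := {mpoly K[n]}.

(* [hM d] is the set of homogeneous elements of degree d of the N-graded
   R-module M. *)
Variables (M : lmodType R) (hM : nat -> M -> Prop).

(* In position a, the module is F_a = \bigoplus_(j < res_rank a) R(- res_deg j),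
   whose elements are row vectors; the differential F_(a+1) -> F_a is right
   multiplication by [res_diff a], and the augmentation F_0 -> M sends the j-th
   basis vector to [res_aug j]. *)
Record resolution_data := ResolutionData {
  res_rank : nat -> nat;
  res_deg : forall a, 'I_(res_rank a) -> nat;
  res_diff : forall a, 'M[R]_(res_rank a.+1, res_rank a);
  res_aug : 'I_(res_rank 0) -> M
}.

Definition augmentation (F : resolution_data) (v : 'rV[R]_(res_rank F 0)) : M :=
  \sum_j v ord0 j *: res_aug j.

Record minimal_graded_free_resolution (F : resolution_data) : Prop := {
  (* all maps are homogeneous of degree 0 *)
  aug_homog : forall j : 'I_(res_rank F 0), hM (res_deg j) (res_aug j);
  diff_homog : forall a (i : 'I_(res_rank F a.+1)) (j : 'I_(res_rank F a)),
    res_diff F a i j != 0 ->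
    exists2 e : nat,
      res_deg i = (res_deg j + e)%N & res_diff F a i j \is e.-homog;
  (* exactness of ... -> F_1 -> F_0 -> M -> 0 *)
  aug_surj : forall x : M, exists v, x = @augmentation F v;
  exact0 : forall v : 'rV[R]_(res_rank F 0),
    augmentation v = 0 <-> exists w, v = w *m res_diff F 0;
  exactS : forall a (v : 'rV[R]_(res_rank F a.+1)),
    v *m res_diff F a = 0 <-> exists w, v = w *m res_diff F a.+1;
  (* minimality: the image of F_(a+1) lies in (x_1, ..., x_n) F_a *)
  diff_minimal : forall a (i : 'I_(res_rank F a.+1)) (j : 'I_(res_rank F a)),
    (res_diff F a i j)@_0%MM = 0
}.

Definition generator_count (F : resolution_data) (a b : nat) : nat :=
  #|[set j : 'I_(res_rank F a) | res_deg j == b]|.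

Definition betti_spec (a b k : nat) : Prop :=
  exists2 F, minimal_graded_free_resolution F & generator_count F a b = k.

(* The k such that [betti_spec a b k]: it exists because finitely generated
   graded modules have minimal graded free resolutions, and is unique because
   these are unique up to isomorphism (junk value 0 for other modules). *)
Definition betti (a b : nat) : nat :=
  if pselect (exists k, betti_spec a b k) is left h then projT1 (cid h) else 0%N.

(* reg M = r *)
Definition is_regularity (r : int) : Prop :=
  (exists a b : nat, betti a b != 0%N /\ b%:Z - a%:Z = r) /\
  (forall a b : nat, betti a b != 0%N -> b%:Z - a%:Z <= r).

End Resolutions.

Section DegreeResolution.
Variables (K : fieldType) (n : nat) (I : idealr {mpoly K[n]}).

Definition minimal_monomial_generator (m : 'X_{1..n}) : Prop :=
  'X_[m] \in (I : {pred {mpoly K[n]}}) /\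
  forall m' : 'X_{1..n},
    (m' <= m)%MM -> 'X_[m'] \in (I : {pred {mpoly K[n]}}) -> m' = m.

(* omega(I) = w *)
Definition is_omega (w : nat) : Prop :=
  (exists2 m, minimal_monomial_generator m & mdeg m = w) /\
  (forall m, minimal_monomial_generator m -> (mdeg m <= w)%N).

Definition has_degree_resolution : Prop :=
  exists2 w : nat, is_omega w &
    forall a b : nat, (a + w < b)%N -> betti (@ideal_homog K n I) a b = 0%N.

End DegreeResolution.

Section KrullDimension.
Variable A : comNzRingType.

Definition is_prime_ideal (P : {pred A}) : Prop :=
  idealr_closed P /\ prime_idealr_closed P.

Definition prime_chain (l : nat) (P : nat -> {pred A}) : Prop :=
  (forall k, (k <= l)%N -> is_prime_ideal (P k)) /\
  (forall k, (k < l)%N ->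
     {subset P k <= P k.+1} /\ exists x, x \in P k.+1 /\ x \notin P k).

(* dim A = d *)
Definition is_krull_dim (d : nat) : Prop :=
  (exists P, prime_chain d P) /\
  (forall l P, prime_chain l P -> (l <= d)%N).

End KrullDimension.

(* Main.v *)
(** The Koszul complex of [x_1, ..., x_n] detects regularity: if the Koszul
    homology of a graded module vanishes wherever the coefficients have degree
    [> r], then H_0 bounds the degrees of minimal generators by [r], and
    dimension shifting along [0 -> Omega -> F -> M -> 0] gives the same for the
    syzygy module with [r + 1].  Hence in every minimal graded free resolution
    the generators in position [a] have degree at most [a + r]; the same bound
    shows that such a resolution exists, since each syzygy module is generated
    by finitely many finite-dimensional graded pieces.

    For K[G] with all faces of G of size at most [d], dividing by a variable that
    occurs at least twice in the multidegree is a contracting homotopy off the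
    squarefree multidegrees, and there the coefficients are face monomials, of
    degree at most [d].  So K[G] is [d]-regular and I_G is [(d+1)]-regular.  If G
    is the (d-1)-skeleton of a larger complex, a face of size [d + 1] of the
    latter is a minimal non-face of G of the largest possible size; it gives
    omega(I_G) = d + 1 and a first syzygy of degree [d + 1].

    The Krull dimension is bounded below by the primes of the faces in a flag.
    For the bound above, the prime at the bottom of a chain contains all the
    variables off some face, so that [d + 1] elements are algebraically dependent
    modulo it; picking them in the successive differences of the chain, the
    lexicographically smallest monomials of such a relation contradict primality
    (Coquand and Lombardi). *)

From HB Require Import structures.
Require Import Defs.
From mathcomp Require Import all_boot all_order all_algebra.
From mathcomp Require Import boolp ring.
From mathcomp.multinomials Require Import mpoly.
Import Order.TTheory GRing.Theory Num.Theory.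
Local Open Scope ring_scope.
Local Open Scope quotient_scope.
Set Implicit Arguments.
Unset Strict Implicit.
Unset Printing Implicit Defensive.

(** * The Koszul complex *)

Section KoszulDifferential.
Variables (K : fieldType) (n : nat).
Local Notation R := {mpoly K[n]}.
Implicit Types (S T : {set 'I_n}) (k l : 'I_n) (m : 'X_{1..n}) (p : R).

(** For l outside T, [(-1) ^+ kpos l T] is the sign with which e_l /\ e_T equals the basis element
    of [l |: T]. *)
Definition kpos l T : nat := #|[set t in T | (t < l)%N]|.

Lemma kposU k l T : k \notin T -> kpos l (k |: T) = ((k < l) + kpos l T)%N.
Proof.
move=> kT; rewrite /kpos; have [kl|kl] := boolP (k < l)%N.
  rewrite (_ : finset _ = k |: [set t in T | (t < l)%N]) ?cardsU1 ?inE ?(negPf kT) //.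
  apply/setP => t; rewrite !inE andb_orl.
  by have [->|] := eqVneq t k; rewrite ?kl ?(negPf kT).
congr #|pred_of_set _|; apply/setP => t; rewrite !inE andb_orl.
by have [->|] := eqVneq t k; rewrite ?(negPf kl) // (negPf kT).
Qed.

Lemma kposU1 l T : kpos l (l |: T) = kpos l T.
Proof.
congr #|pred_of_set _|; apply/setP => t; rewrite !inE andb_orl.
by have [->|] := eqVneq t l; rewrite ?ltnn ?andbF.
Qed.

Section Module.
Variable M : lmodType R.
Implicit Types z w : {set 'I_n} -> M.

(* The chain z stands for the element \sum_T e_T (x) z T of the Koszul complex
   of x_1, ..., x_n with coefficients in M. *)
Definition kdiff z T : M :=
  \sum_(l | l \notin T) ((-1) ^+ kpos l T * 'X_l) *: z (l |: T).

Lemma kdiffB z w T : kdiff (fun S => z S - w S) T = kdiff z T - kdiff w T.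
Proof.
by rewrite /kdiff -sumrB; apply: eq_bigr => l _; rewrite scalerBr.
Qed.

Lemma eq_kdiff z w : z =1 w -> kdiff z =1 kdiff w.
Proof. by move=> zw T; apply: eq_bigr => l _; rewrite zw. Qed.

(** Deleting l and k in the two possible orders gives the same term with opposite signs, so the
    double sum cancels in pairs. *)
Lemma kdiffK z T : kdiff (kdiff z) T = 0.
Proof.
pose G l k := ((-1) ^+ kpos l T * 'X_l) *:
  (((-1) ^+ kpos k (l |: T) * 'X_k) *: z (k |: (l |: T))).
have GE l k : l \notin T -> k \notin T -> (l < k)%N -> G l k + G k l = 0.
  move=> lT kT lk; rewrite /G !scalerA setUCA -scalerDl.
  rewrite !kposU // lk ltnNge (ltnW lk) /= add0n add1n exprS.
  move: ((-1) ^+ kpos l T : R) ((-1) ^+ kpos k T : R) ('X_l : R) ('X_k : R) => a b x y.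
  rewrite (_ : _ + _ = 0) ?scale0r //.
  by ring.
rewrite /kdiff (eq_bigr (fun l => \sum_(k | (k \notin T) && (k != l)) G l k)); last first.
  move=> l lT; rewrite scaler_sumr; apply: eq_bigl => k.
  by rewrite !inE negb_or andbC.
rewrite (eq_bigr (fun l => \sum_(k | (k \notin T) && (k < l)%N) G l k +
   \sum_(k | (k \notin T) && (l < k)%N) G l k)); last first.
  move=> l lT; rewrite (bigID (fun k : 'I_n => (k < l)%N)) /=; congr (_ + _).
    by apply: eq_bigl => k; case: (k \notin T) => //=;
    rewrite -(inj_eq val_inj) /=; case: ltngtP.
  apply: eq_bigl => k; case: (k \notin T) => //=.
  by rewrite -(inj_eq val_inj) /=; case: ltngtP.
rewrite big_split /= (exchange_big_dep (fun k => k \notin T)) /=; last by move=> l k _ /andP[].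
rewrite -big_split big1 //= => l lT.
rewrite (eq_bigl (fun k : 'I_n => (k \notin T) && (l < k)%N)); last by move=> k; rewrite lT.
by rewrite -big_split big1 //= => k /andP[kT lk]; rewrite addrC GE.
Qed.

End Module.

Lemma kdiff_lin (M N : lmodType R) (f : {linear M -> N}) (z : {set 'I_n} -> M) T :
  kdiff (fun S => f (z S)) T = f (kdiff z T).
Proof. by rewrite /kdiff linear_sum; apply: eq_bigr => l _; rewrite linearZ. Qed.

Lemma mcoeff_signM j p m : ((-1) ^+ j * p)@_m = (-1) ^+ j * p@_m.
Proof.
have -> : (-1 : R) ^+ j = ((-1) ^+ j)%:MP by rewrite rmorphXn /= rmorphN rmorph1.
by rewrite mcoeffCM.
Qed.

Lemma mcoeff_mulX p m m' :
  (p * 'X_[m'])@_m = if (m' <= m)%MM then p@_(m - m') else 0.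
Proof.
case: ifP => mm; first by rewrite -{1}(submK mm) addmC mcoeffMX.
apply: memN_msupp_eq0; rewrite (perm_mem (msuppMX _ _)).
by apply: contraFN mm => /mapP[m'' _ ->]; apply: lem_addr.
Qed.

Lemma mcoeffXUM l p m :
  ('X_l * p)@_m = if (0 < m l)%N then p@_(m - U_(l)) else 0.
Proof. by rewrite mulrC mcoeff_mulX lep1mP lt0n. Qed.

Lemma sum_msupp_delta p m (x : K) : (p@_m = 0 -> x = 0) ->
  \sum_(m' <- msupp p) (if m' == m then x else 0) = x.
Proof.
move=> px; have [mp|/memN_msupp_eq0 /px ->] := boolP (m \in msupp p).
  by rewrite (bigD1_seq _ mp) ?msupp_uniq //= eqxx big1 ?addr0 // => m' /negPf ->.
by rewrite big1 // => m' _; rewrite if_same.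
Qed.

Definition mshift (P : pred 'X_{1..n}) l p : R :=
  \sum_(m <- msupp p | P m && (0 < m l)%N) p@_m *: 'X_[m - U_(l)].

Lemma mcoeff_mshift P l p m :
  (mshift P l p)@_m = if P (m + U_(l))%MM then p@_(m + U_(l)) else 0.
Proof.
rewrite /mshift raddf_sum big_mkcond /=.
rewrite -[RHS](@sum_msupp_delta p (m + U_(l))%MM) => [|->]; last exact: if_same.
apply: eq_bigr => m' _; case: ifP => [/andP[Pm' m'l]|].
  rewrite mcoeffZ mcoeffX.
  have -> : ((m' - U_(l))%MM == m) = (m' == (m + U_(l))%MM).
    by rewrite -(inj_eq (@addIm _ U_(l)%MM)) submK // lep1mP -lt0n.
  by case: eqP => [<-|]; rewrite ?Pm' ?mulr1 ?mulr0.
by case: eqP => // ->; rewrite mnmDE mnm1E eqxx addn1 andbT => ->.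
Qed.

(** The exponent vector of x_S, which is also the multidegree of e_S in the Koszul complex of R. *)
Definition mset S : 'X_{1..n} := [multinom (l \in S : nat) | l < n].

Lemma msetE S l : mset S l = (l \in S).
Proof. by rewrite mnmE. Qed.

Lemma msetD1 S l m : l \in S -> (m + U_(l) + mset (S :\ l) = m + mset S)%MM.
Proof.
move=> lS; apply/mnmP => k; rewrite !mnmDE mnm1E !msetE !inE.
by have [<-|] := eqVneq l k; rewrite ?lS ?addn0 // eq_sym => /negPf ->; rewrite addn0.
Qed.

Lemma msetU1 S l m : l \notin S -> (0 < m l)%N ->
  (m - U_(l) + mset (l |: S) = m + mset S)%MM.
Proof.
move=> lS ml; rewrite -(@msetD1 (l |: S) l) ?inE ?eqxx // setU1K //.
by rewrite submK // lep1mP -lt0n.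
Qed.

Section Homotopy.
Variables (pick : 'X_{1..n} -> option 'I_n).
Hypothesis pick_gt0 : forall m l, pick m = Some l -> (0 < m l)%N.
Implicit Types f : {set 'I_n} -> R^o.

(* On the basis element e_S x^m it is e_l /\ (e_S x^m / x_l), where l is chosen
   from the multidegree of e_S x^m alone. *)
Definition khomot f S : R^o :=
  \sum_(l in S) (-1) ^+ kpos l S *
    mshift (fun m => pick (m + mset (S :\ l))%MM == Some l) l (f (S :\ l)).

Lemma mcoeff_khomot f S m : (khomot f S : R)@_m =
  if pick (m + mset S)%MM is Some l then
    if l \in S then (-1) ^+ kpos l S * (f (S :\ l) : R)@_(m + U_(l)) else 0
  else 0.
Proof.
rewrite /khomot raddf_sum /=.
rewrite (eq_bigr (fun l => if pick (m + mset S)%MM == Some l then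
   (-1) ^+ kpos l S * (f (S :\ l) : R)@_(m + U_(l)) else 0)); last first.
  move=> l lS; rewrite mcoeff_signM mcoeff_mshift msetD1 //.
  by case: ifP => //; rewrite mulr0.
case: (pick _) => [l|]; last by rewrite big1.
have [lS|lS] := boolP (l \in S).
  rewrite (bigD1 l) //= eqxx big1 ?addr0 // => k /andP[_ kl].
  by case: eqP => // -[lk]; rewrite lk eqxx in kl.
by rewrite big1 // => k kS; case: (_ =P _) => // -[lk]; rewrite -lk (negPf lS) in kS.
Qed.

Lemma mcoeff_kdiff f S m : (kdiff f S : R)@_m =
  \sum_(l | l \notin S) (-1) ^+ kpos l S *
    (if (0 < m l)%N then (f (l |: S) : R)@_(m - U_(l)) else 0).
Proof.
rewrite /kdiff raddf_sum; apply: eq_bigr => l _ /=.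
by rewrite -[_ *: _]mulrA mcoeff_signM mcoeffXUM.
Qed.

(** Neither map changes the multidegree of e_S x^m, so the same l is picked in every term. For a
    fixed l this is the Leibniz rule d(e_l /\ z) + e_l /\ d z = x_l z, divided by x_l. *)
Lemma khomotopy f S m :
  (kdiff (khomot f) S : R)@_m + (khomot (kdiff f) S : R)@_m =
  if pick (m + mset S)%MM is Some _ then (f S : R)@_m else 0.
Proof.
rewrite mcoeff_khomot mcoeff_kdiff.
rewrite (eq_bigr (fun k => (-1) ^+ kpos k S * (if (0 < m k)%N then
  if pick (m + mset S)%MM is Some l then
    if l \in k |: S then
      (-1) ^+ kpos l (k |: S) * (f ((k |: S) :\ l) : R)@_(m - U_(k) + U_(l)) else 0
    else 0 else 0))); last first.
  by move=> k kS; case: ifP => // mk; rewrite mcoeff_khomot msetU1.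
case E: (pick _) => [l|]; last by rewrite big1 ?addr0 // => k _; rewrite if_same mulr0.
have := pick_gt0 E; rewrite mnmDE msetE => ml.
have [lS|lS] := boolP (l \in S); last first.
  rewrite (negPf lS) addn0 in ml.
  rewrite addr0 (bigD1 l) //= ml !inE eqxx /= kposU1 setU1K //.
  rewrite submK ?lep1mP -?lt0n // signrMK big1 ?addr0 // => k /andP[kS kl].
  by rewrite !inE (negPf lS) orbF eq_sym (negPf kl) if_same mulr0.
have kposD1 k : kpos k S = ((l < k) + kpos k (S :\ l))%N.
  by rewrite -kposU ?setD1K ?setD11.
(* The term of l in the inner differential restores [f S]; the others cancel against the first
   sum. *)
rewrite mcoeff_kdiff [X in _ + _ * X](bigD1 l) /=; last by rewrite setD11.
rewrite setD1K // mnmDE mnm1E eqxx addn1 /= addmK mulrDr mulrA.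
have kposl : kpos l (S :\ l) = kpos l S by rewrite kposD1 ltnn.
rewrite kposl -expr2 sqrr_sign mul1r.
rewrite addrCA mulr_sumr [X in _ + X](_ : _ = 0) ?addr0 //.
rewrite [X in _ + X](eq_bigl (fun k => k \notin S)); last first.
  move=> k; rewrite !inE; have [->|] := eqVneq k l; rewrite ?lS //=.
  by rewrite andbT.
rewrite -big_split big1 //= => k kS.
have kl : k != l by apply: contraNneq kS => ->.
rewrite mnmDE mnm1E eq_sym (negPf kl) addn0 !inE lS orbT.
case: ifP => // mk; last by rewrite !mulr0 addr0.
rewrite kposU // (kposD1 k).
have -> : (k |: S) :\ l = k |: (S :\ l).
  by apply/setP => t; rewrite !inE; have [->|//] := eqVneq t l; rewrite eq_sym (negPf kl).
have -> : (m + U_(l) - U_(k) = m - U_(k) + U_(l))%MM.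
  apply/mnmP => t; rewrite !(mnmDE, mnmBE, mnm1E).
  have [<-|] := eqVneq k t; last by rewrite !subn0.
  by rewrite eq_sym (negPf kl) !addn0.
rewrite !exprD !mulrA -mulrDl.
have -> : (-1 : K) ^+ (l < k)%N = - (-1) ^+ (k < l)%N.
  by have : (k : nat) != l by []; case: ltngtP => //= _ _; rewrite ?expr1 ?expr0 ?opprK.
set a := _ ^+ _.
rewrite [X in X + _](_ : _ =
  - (a * a * (-1) ^+ kpos k (S :\ l) * (-1) ^+ kpos l S)); last first.
  by rewrite !mulNr; congr (- _); rewrite (mulrAC a).
by rewrite -expr2 sqrr_sign mul1r [_ ^+ _ * _ ^+ _]mulrC addNr mul0r.
Qed.

End Homotopy.
End KoszulDifferential.

(** * Graded modules and Koszul regularity *)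

Section Regularity.
Variables (K : fieldType) (n : nat).
Local Notation R := {mpoly K[n]}.

(** The sum of the pieces is direct but is not asked to be all of M: a submodule, such as a kernel,
    is given by its graded pieces inside the ambient module. *)
Record grading (M : lmodType R) (hM : nat -> M -> Prop) : Prop := Grading {
  grading0 : forall d, hM d 0;
  gradingB : forall d x y, hM d x -> hM d y -> hM d (x - y);
  gradingZ : forall d e (p : R) x, p \is e.-homog -> hM d x -> hM (d + e)%N (p *: x);
  grading_indep : forall N (y : nat -> M), (forall e, hM e (y e)) ->
    \sum_(e < N) y e = 0 -> forall e, (e < N)%N -> y e = 0
}.

(* Castelnuovo-Mumford regularity at most r, read off Koszul homology: the
   homology of K(x) (x) M vanishes wherever the coefficients have degree > r. *)
Definition koszul_regular (M : lmodType R) (hM : nat -> M -> Prop) (r : nat) : Prop :=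
  forall c (z : {set 'I_n} -> M), (r <= c)%N -> (forall S, hM c.+1 (z S)) ->
    (forall S, kdiff z S = 0) ->
  exists2 w, (forall S, hM c (w S)) & forall S, kdiff w S = z S.

Definition kernel_grading (M N : lmodType R) (hM : nat -> M -> Prop) (f : M -> N) :=
  fun d x => hM d x /\ f x = 0.

(** The degree b part of (x_1, ..., x_n) M: each x_l has degree 1, so coefficients of degree b - 1
    suffice, and there are none when b = 0. *)
Definition decomposable (M : lmodType R) (hM : nat -> M -> Prop) b x : Prop :=
  if b is c.+1 then
    exists2 y : 'I_n -> M, (forall l, hM c (y l)) & x = \sum_l 'X_l *: y l
  else x = 0.

Section Grading.
Variables (M : lmodType R) (hM : nat -> M -> Prop).
Hypothesis grM : grading hM.

Lemma gradingN d x : hM d x -> hM d (- x).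
Proof. by move=> hx; rewrite -[- x]add0r; apply: gradingB => //; apply: grading0. Qed.

Lemma gradingD d x y : hM d x -> hM d y -> hM d (x + y).
Proof. by move=> hx hy; rewrite -[y]opprK; apply: gradingB => //; apply: gradingN. Qed.

Lemma grading_sum d (I : Type) (s : seq I) (P : pred I) (F : I -> M) :
  (forall i, P i -> hM d (F i)) -> hM d (\sum_(i <- s | P i) F i).
Proof.
by move=> hF; elim/big_ind: _ => //; [apply: grading0|apply: gradingD].
Qed.

Lemma dhomog_sign (j : nat) : ((-1) ^+ j : R) \is 0.-homog.
Proof. by rewrite -signr_odd; case: odd; rewrite ?expr1 ?expr0 ?rpredN dhomog1. Qed.

Lemma dhomogXU (l : 'I_n) : ('X_l : R) \is 1.-homog.
Proof. by rewrite dhomogX /= mdeg1. Qed.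

Lemma dhomog_signX (j : nat) (l : 'I_n) : ((-1) ^+ j * 'X_l : R) \is 1.-homog.
Proof. by rewrite -[1%N]add0n; apply: dhomogM; rewrite ?dhomog_sign ?dhomogXU. Qed.

Lemma grading_kdiff c (z : {set 'I_n} -> M) S :
  (forall S, hM c (z S)) -> hM c.+1 (kdiff z S).
Proof.
move=> hz; apply: grading_sum => l _; rewrite -addn1.
by apply: gradingZ => //; apply: dhomog_signX.
Qed.

Lemma koszul_regularW r r' : (r <= r')%N ->
  koszul_regular hM r -> koszul_regular hM r'.
Proof. by move=> rr reg c z rc; apply: reg; apply: leq_trans rc. Qed.

(** An element of M placed at the empty set is a cycle; for it to be a boundary means to lie in
    (x_1, ..., x_n) M. *)
Lemma koszul_regular_generated r c x : koszul_regular hM r -> (r <= c)%N ->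
  hM c.+1 x -> decomposable hM c.+1 x.
Proof.
move=> reg rc hx.
have [||w hw dw] := reg c (fun S => if S == set0 then x else 0) rc.
- by move=> S; case: ifP => // _; apply: grading0.
- move=> S; rewrite /kdiff big1 // => l _; rewrite ifF ?scaler0 //.
  by apply/negbTE/set0Pn; exists l; rewrite !inE eqxx.
exists (fun l => w [set l]) => // ; have := dw set0; rewrite eqxx => <-.
rewrite /kdiff (eq_bigl predT) => [|l]; last by rewrite inE.
apply: eq_bigr => l _; rewrite setU0 (_ : kpos _ _ = 0%N) ?expr0 ?mul1r //.
by apply/eqP; rewrite /kpos cards_eq0; apply/eqP/setP => t; rewrite !inE.
Qed.

Lemma grading_component N (y : nat -> M) b x : (b < N)%N -> (forall e, hM e (y e)) ->
  hM b x -> x = \sum_(e < N) y e -> x = y b.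
Proof.
move=> bN hy hx xE.
pose y' e := if e == b then y e - x else y e.
have hy' e : hM e (y' e).
  by rewrite /y'; case: eqP => [->|_] //; apply: gradingB.
have /(_ b bN) : forall e, (e < N)%N -> y' e = 0.
  apply: (grading_indep grM hy').
  rewrite (bigD1 (Ordinal bN)) //= /y' eqxx.
  rewrite (eq_bigr (fun e : 'I_N => y e)); last first.
    by move=> e; rewrite -(inj_eq val_inj) /= => /negPf ->.
  by rewrite addrAC [X in X - _ = _](_ : _ = x) ?subrr // xE [RHS](bigD1 (Ordinal bN)).
by rewrite /y' eqxx => /eqP; rewrite subr_eq0 => /eqP.
Qed.

Lemma kernel_gradingP (N : lmodType R) (f : {linear M -> N}) :
  grading (kernel_grading hM f).
Proof.
split=> [d|d x y [hx fx] [hy fy]|d e p x hp [hx fx]|N' y hy].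
- by split; [apply: grading0|rewrite linear0].
- by split; [apply: gradingB|rewrite linearB fx fy subrr].
- by split; [apply: gradingZ|rewrite linearZZ fx scaler0].
by apply: (grading_indep grM) => e; case: (hy e).
Qed.

(* Dimension shifting along 0 -> ker f -> M -> N -> 0. *)
Lemma koszul_regular_kernel (N : lmodType R) (hN : nat -> N -> Prop)
    (f : {linear M -> N}) r :
  (forall d x, hM d x -> hN d (f x)) ->
  (forall d y, hN d y -> exists2 x, hM d x & y = f x) ->
  koszul_regular hM r -> koszul_regular hN r ->
  koszul_regular (kernel_grading hM f) r.+1.
Proof.
move=> hf fsurj regM regN [//|c] z rc hz dz.
have [w hw dw] := regM _ z (leqW rc) (fun S => (hz S).1) dz.
have [||u hu du] := regN c (fun S => f (w S)) rc.
- by move=> S; apply: hf.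
- by move=> S; rewrite kdiff_lin dw (hz S).2.
have /choice [v hv] : forall S, exists v, hM c v /\ u S = f v.
  by move=> S; have [v] := fsurj _ _ (hu S); exists v.
(* Subtracting from [w] the boundary of the lift [v] of [u] moves it into the kernel of f and leaves
   its own boundary unchanged. *)
exists (fun S => w S - kdiff v S) => S; last by rewrite kdiffB dw kdiffK subr0.
split; first by apply: gradingB => //; apply: grading_kdiff => T; have [] := hv T.
rewrite linearB -du -kdiff_lin; apply/eqP; rewrite subr_eq0; apply/eqP.
by apply: eq_kdiff => T; have [] := hv T.
Qed.

End Grading.

(** Carries regularity from the kernel of R -> R/I, whose carrier is R, to the type of elements of
    I. *)
Lemma koszul_regular_inj (M N : lmodType R) (hM : nat -> M -> Prop)
    (hN : nat -> N -> Prop) (f : {linear M -> N}) r :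
  injective f -> (forall d x, hM d x <-> hN d (f x)) ->
  (forall d y, hN d y -> exists x, y = f x) ->
  koszul_regular hN r -> koszul_regular hM r.
Proof.
move=> finj hf fsurj reg c z rc hz dz.
have [||w hw dw] := reg c (fun S => f (z S)) rc.
- by move=> S; apply/hf.
- by move=> S; rewrite kdiff_lin dz linear0.
have /choice [v hv] : forall S, exists v, w S = f v.
  by move=> S; apply: fsurj (hw S).
exists v => S; first by apply/hf; rewrite -hv.
by apply: finj; rewrite -kdiff_lin -dw; apply: eq_kdiff => T.
Qed.

Lemma homog_khomot pick c (f : {set 'I_n} -> R^o) S :
  (forall S, (f S : R) \is c.+1.-homog) -> (khomot pick f S : R) \is c.-homog.
Proof.
move=> hf; apply/dhomogP => m; rewrite mcoeff_msupp mcoeff_khomot.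
case: (pick _) => [l|]; last by rewrite eqxx.
case: ifP => lS; last by rewrite eqxx.
rewrite mulf_eq0 signr_eq0 /= -mcoeff_msupp => /(dhomogP _ _ _ (hf _)).
by rewrite /= mdegD mdeg1 addn1 => -[->].
Qed.

Definition poly_homog (d : nat) (p : R^o) : Prop := (p : R) \is d.-homog.

Lemma poly_grading : grading poly_homog.
Proof.
split=> [d|d x y hx hy|d e p x hp hx|N y hy y0 e eN]; rewrite /poly_homog.
- exact: dhomog0.
- exact: rpredB.
- by rewrite addnC; apply: dhomogM.
have := congr1 (pihomog mdeg e) y0; rewrite raddf0 raddf_sum /= => <-.
rewrite (bigD1 (Ordinal eN)) //= pihomog_dE ?big1 ?addr0 //; last exact: hy.
move=> i; rewrite -(inj_eq val_inj) /= => ie.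
exact: (pihomog_ne0 ie (hy i)).
Qed.

(** Any variable dividing the multidegree of e_S x^m gives a contracting homotopy. Only multidegree
    0 is left out, and it does not occur with coefficients of positive degree. *)
Lemma koszul_regular_poly : koszul_regular poly_homog 0.
Proof.
move=> c z _ hz dz; pose pck (m : 'X_{1..n}) := [pick l | (0 < m l)%N].
have pckP m l : pck m = Some l -> (0 < m l)%N.
  by rewrite /pck; case: pickP => // l' ml' [<-].
exists (khomot pck z) => S; first exact: homog_khomot.
apply/mpolyP => m; have := khomotopy pckP z S m.
rewrite [X in _ + X](_ : _ = 0) ?addr0 => [->|]; last first.
  rewrite mcoeff_khomot; case: (pck _) => // l; case: ifP => // _.
  by rewrite dz mcoeff0 mulr0.
rewrite /pck; case: pickP => // m0; apply/esym/(dhomog_nemf_coeff (hz S)).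
rewrite /= mdegE big1 // => l _; have := m0 l.
by rewrite mnmDE; case: (m l).
Qed.

End Regularity.

(** * Graded free modules and minimal covers *)

Section FreeModules.
Variables (K : fieldType) (n : nat).
Local Notation R := {mpoly K[n]}.

Section Combination.
Variables (M : lmodType R) (k : nat) (g : 'I_k -> M).

Definition rv_comb (v : 'rV[R]_k) : M := \sum_j v ord0 j *: g j.

Lemma rv_comb_is_linear : linear rv_comb.
Proof.
move=> a u v; rewrite /rv_comb scaler_sumr -big_split /=; apply: eq_bigr => j _.
by rewrite !mxE scalerDl scalerA.
Qed.

HB.instance Definition _ :=
  GRing.isLinear.Build R 'rV[R]_k M _ rv_comb rv_comb_is_linear.

Lemma rv_comb_delta j : rv_comb (delta_mx ord0 j) = g j.
Proof.
rewrite /rv_comb (bigD1 j) //= mxE !eqxx scale1r big1 ?addr0 // => i /negPf ij.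
by rewrite mxE ij andbF scale0r.
Qed.

End Combination.

Lemma mulmx_comb k k' (D : 'M[R]_(k', k)) (v : 'rV[R]_k') :
  v *m D = rv_comb (fun j => row j D) v.
Proof. exact: mulmx_sum_row. Qed.

Section Shifts.
Variables (k : nat) (deg : 'I_k -> nat).

(** The degree b piece of the direct sum of the R(- deg j). The case deg j > b is separate since
    truncated subtraction would turn it into degree 0. *)
Definition rv_homog (b : nat) (v : 'rV[R]_k) : Prop :=
  forall j, if (deg j <= b)%N then v ord0 j \is (b - deg j).-homog else v ord0 j == 0.

Definition rv_pihomog (b : nat) (v : 'rV[R]_k) : 'rV[R]_k :=
  \row_j if (deg j <= b)%N then pihomog mdeg (b - deg j) (v ord0 j) else 0.

Lemma rv_pihomogP b v : rv_homog b (rv_pihomog b v).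
Proof.
by move=> j; rewrite mxE; case: leqP => _; [apply: pihomogP|rewrite eqxx].
Qed.

Lemma rv_pihomog_id b v : rv_homog b v -> rv_pihomog b v = v.
Proof.
move=> hv; apply/rowP => j; rewrite mxE; have := hv j.
by case: leqP => _ => [/pihomog_dE|/eqP].
Qed.

Lemma rv_pihomog_ne0 b d v : d != b -> rv_homog d v -> rv_pihomog b v = 0.
Proof.
move=> db hv; apply/rowP => j; rewrite !mxE; have := hv j.
case: (leqP (deg j) b) => // bj; case: leqP => [dj|_ /eqP->]; last by rewrite pihomog0.
move=> hj; apply: pihomog_ne0 hj; apply: contra db => /eqP E.
by rewrite -(subnK bj) -(subnK dj) E.
Qed.

Lemma rv_pihomog_is_additive b : {morph rv_pihomog b : x y / x - y}.
Proof.
move=> u v; apply/rowP => j; rewrite !mxE.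
by case: leqP => _; rewrite ?pihomogB ?subrr.
Qed.

HB.instance Definition _ b :=
  GRing.isZmodMorphism.Build 'rV[R]_k 'rV[R]_k (rv_pihomog b)
    (rv_pihomog_is_additive b).

Lemma rv_grading : grading rv_homog.
Proof.
split=> [d j|d x y hx hy j|d e p x hp hx j|N y hy y0 e eN].
- by rewrite mxE eqxx dhomog0 if_same.
- rewrite !mxE; have := hx j; have := hy j; case: leqP => _; first by move=> ? ?; apply: rpredB.
  by move=> /eqP -> /eqP ->; rewrite subrr.
- rewrite !mxE; have := hx j; case: leqP => [dj|_ /eqP ->]; last first.
    by rewrite mulr0 eqxx dhomog0 if_same.
  by move=> hj; rewrite (leq_trans dj) ?leq_addr // -addnBAC // addnC dhomogM.
have := congr1 (rv_pihomog e) y0; rewrite raddf0 raddf_sum /= => <-.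
rewrite (bigD1 (Ordinal eN)) //= rv_pihomog_id ?big1 ?addr0 // => i.
rewrite -(inj_eq val_inj) /= => ie.
exact: (rv_pihomog_ne0 ie (hy i)).
Qed.

(** All large N' are allowed, so that the range can also be made to contain a prescribed degree, as
    in [rv_comb_pihomog]. *)
Lemma rv_decomp v : exists N, forall N', (N <= N')%N -> v = \sum_(e < N') rv_pihomog e v.
Proof.
exists (\max_j (deg j + msize (v ord0 j)))%N => N' NN'; apply/rowP => j; rewrite summxE.
have {NN'} jN : (deg j + msize (v ord0 j) <= N')%N.
  by apply: leq_trans NN'; apply: (leq_bigmax j).
pose c e := if (deg j <= e)%N then pihomog mdeg (e - deg j) (v ord0 j) else 0.
rewrite (eq_bigr (fun e : 'I_N' => c e)); last by move=> e _; rewrite mxE.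
rewrite -(big_mkord xpredT c) {}/c.
have dN : (deg j <= N')%N by apply: leq_trans jN; apply: leq_addr.
rewrite (big_cat_nat (leq0n (deg j)) dN) /= big_nat big1 ?add0r; last first.
  by move=> e /andP[_]; rewrite ltnNge => /negPf ->.
rewrite -{1}[deg j]add0n big_addn big_mkord.
rewrite (eq_bigr (fun e : 'I_(N' - deg j) => pihomog mdeg e (v ord0 j))); last first.
  by move=> e _; rewrite leq_addl addnK.
by apply: pihomog_partitionE; rewrite leq_subRL // .
Qed.

(** The Koszul complex of a free module splits along the basis. In degrees above every shift the
    entries have positive degree, where R has no Koszul homology. *)
Lemma rv_regular r : (forall j, deg j <= r)%N -> koszul_regular rv_homog r.
Proof.
move=> degr c z rc hz dz.
have dc j : (deg j <= c)%N by apply: leq_trans rc.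
have /choice [w hw] : forall j, exists w : {set 'I_n} -> R^o,
    (forall S, poly_homog (c - deg j) (w S)) /\
    forall S, kdiff w S = z S ord0 j.
  move=> j; have [|S|w hw dw] := @koszul_regular_poly K n (c - deg j)%N
      (fun S => z S ord0 j) (leq0n _); last by exists w.
    by move=> S; have := hz S j; rewrite (leq_trans (dc j)) // subSn.
  transitivity (kdiff z S ord0 j); last by rewrite dz mxE.
  by rewrite /kdiff summxE; apply: eq_bigr => l _; rewrite mxE.
exists (fun S => \row_j w j S) => S.
  by move=> j; rewrite dc mxE; apply: (hw j).1.
apply/rowP => j; rewrite -(hw j).2 /kdiff summxE.
by apply: eq_bigr => l _; rewrite !mxE.
Qed.

End Shifts.

Section Covers.
Variables (M : lmodType R) (hM : nat -> M -> Prop).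
Hypothesis grM : grading hM.
Variables (k : nat) (deg : 'I_k -> nat) (g : 'I_k -> M).

Section Homogeneous.
Hypothesis homog_g : forall j, hM (deg j) (g j).

Lemma rv_comb_homog b v : rv_homog deg b v -> hM b (rv_comb g v).
Proof.
move=> hv; apply: grading_sum => // j _; have := hv j.
case: leqP => [dj hj|_ /eqP ->]; last by rewrite scale0r; apply: grading0.
by rewrite -(subnKC dj); apply: (gradingZ grM).
Qed.

Lemma rv_comb_pihomog b v : hM b (rv_comb g v) ->
  rv_comb g v = rv_comb g (rv_pihomog deg b v).
Proof.
move=> hx; have [N vE] := rv_decomp deg v.
apply: (@grading_component _ _ _ _ grM (maxn N b.+1) (fun e => rv_comb g (rv_pihomog deg e v))).
- by rewrite leq_max leqnn orbT.
- by move=> e; apply/rv_comb_homog/rv_pihomogP.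
- by [].
by rewrite -linear_sum -vE ?leq_maxl.
Qed.

Lemma kernel_pihomog v : rv_comb g v = 0 ->
  forall b, kernel_grading (rv_homog deg) (rv_comb g) b (rv_pihomog deg b v).
Proof.
move=> v0 b; split; first exact: rv_pihomogP.
by rewrite -rv_comb_pihomog v0 //; apply: grading0.
Qed.

End Homogeneous.

(** Minimality is imposed on the relations, whose entries have no constant term. When the covered
    module is a kernel in a resolution, this is [diff_minimal] for the next differential. *)
Record minimal_cover : Prop := MinimalCover {
  cover_homog : forall j, hM (deg j) (g j);
  cover_gen : forall b x, hM b x -> exists v, x = rv_comb g v;
  cover_min : forall v, rv_comb g v = 0 -> forall j, (v ord0 j)@_0%MM = 0
}.

Hypothesis gP : minimal_cover.

Lemma cover_graded b x : hM b x -> exists2 v, rv_homog deg b v & x = rv_comb g v.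
Proof.
move=> hx; have [v xE] := cover_gen gP hx.
exists (rv_pihomog deg b v); first exact: rv_pihomogP.
by rewrite -rv_comb_pihomog -?xE //; apply: cover_homog.
Qed.

(** If the generator [g j] were decomposable, rewriting it through the cover would give a relation
    with constant term 1 at j. *)
Lemma cover_deg_neq c j :
  (forall x, hM c.+1 x -> decomposable hM c.+1 x) ->
  deg j != c.+1.
Proof.
move=> gen; apply/negP => /eqP dj.
have := cover_homog gP j; rewrite dj => /gen [y hy gE].
have /choice [v vE] : forall l, exists v, y l = rv_comb g v.
  by move=> l; apply: (cover_gen gP (hy l)).
have v0 : rv_comb g (delta_mx ord0 j - \sum_l 'X_l *: v l) = 0.
  rewrite linearB /= rv_comb_delta [rv_comb g (\sum_l _)]linear_sum gE -sumrB big1 // => l _.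
  by rewrite /= linearZZ /= -vE subrr.
have := cover_min gP v0 j.
rewrite !mxE !eqxx summxE /= mcoeffB mcoeff1 eqxx raddf_sum big1.
  by move/eqP; rewrite subr0 oner_eq0.
by move=> l _; rewrite /= mxE mcoeffXUM mnm0E.
Qed.

Lemma cover_deg r j : koszul_regular hM r -> (deg j <= r)%N.
Proof.
move=> reg; rewrite leqNgt; apply/negP => rj.
have /(@cover_deg_neq _ j) :
    forall x, hM (deg j).-1.+1 x -> decomposable hM (deg j).-1.+1 x.
  move=> x; apply: (koszul_regular_generated grM reg).
  by rewrite -ltnS prednK // (leq_ltn_trans _ rj).
by rewrite prednK ?eqxx // (leq_ltn_trans _ rj).
Qed.

Lemma cover_kernel_regular r : koszul_regular hM r ->
  koszul_regular (kernel_grading (rv_homog deg) (rv_comb g)) r.+1.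
Proof.
move=> reg; apply: (koszul_regular_kernel (hN := hM) (rv_grading deg)) => //.
- exact/rv_comb_homog/cover_homog.
- exact: cover_graded.
by apply: rv_regular => j; apply: cover_deg.
Qed.

End Covers.
End FreeModules.

(** * Existence of finite minimal covers *)

Lemma left_kernel (K : fieldType) (m d : nat) (A : 'M[K]_(m, d)) :
  (d < m)%N -> exists2 u : 'rV_m, u != 0 & u *m A = 0.
Proof.
move=> dm; have : kermx A != 0.
  rewrite kermx_eq0 /row_free neq_ltn; apply/orP; left.
  exact: leq_ltn_trans (rank_leq_col _) dm.
by move=> /rowV0Pn [u /sub_kermxP uA u0]; exists u.
Qed.

Lemma mcoeff_pihomog (K : fieldType) (n d : nat) (p : {mpoly K[n]}) m :
  (pihomog mdeg d p)@_m = if mdeg m == d then p@_m else 0.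
Proof.
rewrite pihomogE raddf_sum big_mkcond /=.
rewrite -[RHS](@sum_msupp_delta _ _ p m) => [|->]; last exact: if_same.
apply: eq_bigr => m' _; rewrite mcoeffZ mcoeffX; have [->|] := eqVneq m' m.
  by rewrite mulr1.
by rewrite mulr0 if_same.
Qed.

Section MinimalCovers.
Variables (K : fieldType) (n : nat).
Local Notation R := {mpoly K[n]}.
Variables (M : lmodType R) (hM : nat -> M -> Prop).
Hypothesis grM : grading hM.

(** The spanning family may lie outside the piece of degree b, so that graded submodules inherit the
    property with the same family. *)
Definition locally_finite : Prop := forall b, exists d (e : 'I_d -> M),
  forall x, hM b x -> exists a : 'I_d -> K, x = \sum_i (a i)%:MP *: e i.

Lemma gradingC b (a : K) x : hM b x -> hM b (a%:MP *: x).
Proof.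
move=> hx; rewrite -[b]addn0; apply: gradingZ => //.
by rewrite -[a%:MP]mulr1 mul_mpolyC rpredZ // dhomog1.
Qed.

Lemma decomposable0 b : decomposable hM b 0.
Proof.
case: b => [|c] //=; exists (fun=> 0) => [l|]; first exact: grading0.
by rewrite big1 // => l _; rewrite scaler0.
Qed.

Lemma decomposableD b x y :
  decomposable hM b x -> decomposable hM b y -> decomposable hM b (x + y).
Proof.
case: b => [|c] /= ; first by move=> -> ->; rewrite addr0.
move=> [u hu ->] [v hv ->]; exists (fun l => u l + v l); first by move=> l; apply: gradingD.
by rewrite -big_split; apply: eq_bigr => l _; rewrite scalerDr.
Qed.

Lemma decomposableC b (a : K) x :
  decomposable hM b x -> decomposable hM b (a%:MP *: x).
Proof.
case: b => [->|c [u hu ->]] /=; first by rewrite scaler0.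
exists (fun l => a%:MP *: u l) => [l|]; first exact: gradingC.
by rewrite scaler_sumr; apply: eq_bigr => l _; rewrite !scalerA mulrC.
Qed.

Definition independent_mod b m (s : 'I_m -> M) : Prop :=
  (forall i, hM b (s i)) /\
  forall a : 'I_m -> K, decomposable hM b (\sum_i (a i)%:MP *: s i) ->
    forall i, a i = 0.

(* A family independent modulo decomposables and of maximal size spans the degree
   b piece modulo decomposables (graded Nakayama, without Noetherianity). *)
Lemma minimal_generators b : locally_finite -> exists m (s : 'I_m -> M),
  independent_mod b s /\
  forall x, hM b x -> exists a : 'I_m -> K, exists2 y,
    decomposable hM b y & x = \sum_i (a i)%:MP *: s i + y.
Proof.
move=> /(_ b) [d [e eP]].
have ind0 : exists m, `[< exists s : 'I_m -> M, independent_mod b s >].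
  by exists 0%N; apply/asboolP; exists (fun=> 0); split=> [[]|a _ []].
have indle m : `[< exists s : 'I_m -> M, independent_mod b s >] -> (m <= d)%N.
  move=> /asboolP [s [hs sP]]; rewrite leqNgt; apply/negP => dm.
  have /choice [A AE] := fun i => eP _ (hs i).
  have [u /negP u0 uA] := left_kernel (\matrix_(i, j) A i j) dm; apply: u0.
  apply/eqP/rowP => i; rewrite mxE; move: i; apply: sP.
  rewrite (eq_bigr (fun i => \sum_j (u ord0 i * A i j)%:MP *: e j)); last first.
    move=> i _; rewrite [s i]AE scaler_sumr; apply: eq_bigr => j _.
    by rewrite scalerA -rmorphM.
  rewrite exchange_big big1 /=; first exact: decomposable0.
  move=> j _; rewrite -scaler_suml -raddf_sum /=.
  rewrite (_ : \sum_i _ = (u *m (\matrix_(i, j) A i j)) ord0 j).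
    by rewrite uA mxE mpolyC0 scale0r.
  by rewrite mxE; apply: eq_bigr => i _; rewrite mxE.
case: (ex_maxnP ind0 indle) => m /asboolP [s [hs sP]] mmax.
exists m, s; split=> // x hx.
(* By maximality, [x] appended to [s] satisfies a nontrivial relation modulo decomposables. Its
   coefficient at [x] is nonzero because [s] is independent, and dividing by it solves for [x]. *)
have : ~ independent_mod b (fun i : 'I_m.+1 => oapp s x (unlift ord0 i)).
  by move=> indx; have /mmax := asboolT (ex_intro _ _ indx); rewrite ltnn.
move=> nind; have [a [adec [i ai]]] : exists a : 'I_m.+1 -> K,
    decomposable hM b (\sum_i (a i)%:MP *: oapp s x (unlift ord0 i)) /\
    exists i, a i <> 0.
  apply: contrapT => H; apply: nind; split.
    by move=> i; case: (unlift ord0 i) => [j|] //; apply: hs.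
  move=> a adec i; apply: contrapT => ai; apply: H; exists a; split=> //.
  by exists i.
have sumE (f : 'I_m.+1 -> K) : \sum_i (f i)%:MP *: oapp s x (unlift ord0 i) =
    (f ord0)%:MP *: x + \sum_i (f (lift ord0 i))%:MP *: s i.
  rewrite big_ord_recl unlift_none; congr (_ + _).
  by apply: eq_bigr => j _; rewrite liftK.
rewrite sumE in adec.
have a0 : a ord0 != 0.
  apply/eqP => a0; rewrite a0 mpolyC0 scale0r add0r in adec.
  have aj := sP (fun j => a (lift ord0 j)) adec.
  by case: ai; case: (unliftP ord0 i) => [j|] -> //; apply: aj.
exists (fun j => - ((a ord0)^-1 * a (lift ord0 j))).
exists ((a ord0)^-1%:MP *: ((a ord0)%:MP *: x + \sum_i (a (lift ord0 i))%:MP *: s i)).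
  exact: decomposableC.
rewrite scalerDr scalerA -rmorphM mulVf // rmorph1 scale1r addrCA.
rewrite scaler_sumr -big_split big1 ?addr0 //= => j _.
by rewrite scalerA -rmorphM -scalerDl -rmorphD addNr rmorph0 scale0r.
Qed.

(** The families of [minimal_generators] in degrees up to r are enough, because everything above r
    is decomposable; generation then follows by induction on the degree. *)
Lemma exists_minimal_cover r : locally_finite -> koszul_regular hM r ->
  exists k (deg : 'I_k -> nat) (g : 'I_k -> M), minimal_cover hM deg g.
Proof.
move=> fin reg.
have /choice [ms sP] : forall b, exists ms : {m & 'I_m -> M},
    independent_mod b (projT2 ms) /\
    forall x, hM b x -> exists a : 'I_(projT1 ms) -> K, exists2 y,
      decomposable hM b y & x = \sum_i (a i)%:MP *: projT2 ms i + y.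
  by move=> b; have [m [s sP]] := minimal_generators b fin; exists (existT _ m s).
pose m b := projT1 (ms b); pose s b : 'I_(m b) -> M := projT2 (ms b).
pose T := {b : 'I_r.+1 & 'I_(m b)}.
pose deg (j : 'I_#|{: T}|) : nat := tag (enum_val j).
pose g (j : 'I_#|{: T}|) : M := s (tag (enum_val j)) (tagged (enum_val j)).
have hg j : hM (deg j) (g j) by apply: (sP _).1.1.
have gE b (i : 'I_(m b)) : (b <= r)%N ->
    exists2 j, deg j = b & g j = s b i.
  rewrite -ltnS => br.
  pose t : T := Tagged (fun b : 'I_r.+1 => 'I_(m b)) (i : 'I_(m (Ordinal br))).
  exists (enum_rank t).
    by rewrite /deg enum_rankK.
  by rewrite /g enum_rankK.
exists #|{: T}|, deg, g; split=> //.
  have genD x y : (exists v, x = rv_comb g v) -> (exists v, y = rv_comb g v) ->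
      exists v, x + y = rv_comb g v.
    by move=> [u ->] [v ->]; exists (u + v); rewrite linearD.
  have genZ p x : (exists v, x = rv_comb g v) -> exists v, p *: x = rv_comb g v.
    by move=> [u ->]; exists (p *: u); rewrite linearZ.
  have gen_sum (I : finType) (F : I -> M) : (forall i, exists v, F i = rv_comb g v) ->
      exists v, \sum_i F i = rv_comb g v.
    move=> hF; elim/big_ind: _ => //; exists 0; first by rewrite linear0.
  elim/ltn_ind => b IH x hx.
  have gen_dec y : decomposable hM b y -> exists v, y = rv_comb g v.
    case: b IH {hx} => [_ ->|c IH [u hu ->]]; first by exists 0; rewrite linear0.
    by apply: gen_sum => l; apply/genZ/(IH c).
  have [br|rb] := leqP b r; last first.
    apply: gen_dec; move: hx; rewrite -(ltn_predK rb) => hx.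
    by apply: (koszul_regular_generated grM reg) => //; rewrite -ltnS (ltn_predK rb).
  have [a [y dy ->]] := (sP b).2 x hx.
  apply: genD; last exact: gen_dec.
  apply: gen_sum => i; apply: genZ; have [j _ gj] := gE b i br.
  by exists (delta_mx ord0 j); rewrite rv_comb_delta gj.
(* In the degree [b] component of a relation, the generators of degree [b] have constant
   coefficients and the remaining terms are decomposable, so independence makes the constants
   vanish. *)
move=> v v0 j; pose b := deg j; pose w := rv_pihomog deg b v.
have w0 : rv_comb g w = 0 by have [] := kernel_pihomog grM hg v0 b.
have wE : rv_comb g w = \sum_(t : T) w ord0 (enum_rank t) *: s (tag t) (tagged t).
  rewrite /rv_comb (reindex (@enum_rank T)) /=; last exact/onW_bij/enum_rank_bij.
  by apply: eq_bigr => t _; rewrite /g enum_rankK.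
have br : (b < r.+1)%N by rewrite /b /deg.
pose q i := enum_rank (Tagged (fun b : 'I_r.+1 => 'I_(m b)) (i : 'I_(m (Ordinal br)))).
have dq i : deg (q i) = b by rewrite /deg enum_rankK.
have wb i : w ord0 (q i) = ((v ord0 (q i))@_0%MM)%:MP.
  rewrite mxE dq leqnn subnn; apply/mpolyP => mm.
  by rewrite mcoeff_pihomog mcoeffC mdeg_eq0; case: eqP => [->|]; rewrite ?mulr1 ?mulr0.
have wsum : rv_comb g w = \sum_i ((v ord0 (q i))@_0%MM)%:MP *: s b i +
    \sum_(t : T | tag t != Ordinal br) w ord0 (enum_rank t) *: s (tag t) (tagged t).
  rewrite wE (bigID (fun t : T => tag t == Ordinal br)) /=; congr (_ + _).
  pose F (c : 'I_r.+1) (i : 'I_(m c)) :=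
    w ord0 (enum_rank (Tagged (fun b : 'I_r.+1 => 'I_(m b)) i)) *: s c i.
  transitivity (\sum_(c | c == Ordinal br) \sum_(i | true) F c i).
    by rewrite (sig_big_dep _ (fun _ => xpredT) F); apply: eq_big => -[c i] //=; rewrite andbT.
  by rewrite big_pred1_eq; apply: eq_bigr => i _; rewrite -wb.
have dec t : tag t != Ordinal br ->
    decomposable hM b (w ord0 (enum_rank t) *: s (tag t) (tagged t)).
  move=> tb; have := rv_pihomogP deg b v (enum_rank t); rewrite -/w.
  have -> : deg (enum_rank t) = tag t by rewrite /deg enum_rankK.
  have [tlt|_ /eqP ->] := leqP (tag t) b; last by rewrite scale0r; apply: decomposable0.
  have {}tlt : (tag t < b)%N by rewrite ltn_neqAle tlt andbT.
  have eE : (b - tag t = (b - (tag t).+1).+1)%N by rewrite subnSK.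
  rewrite eE => hw; have [y hy ->] :=
    koszul_regular_generated (poly_grading K n) (@koszul_regular_poly K n) (leq0n _) hw.
  have bE : b = (tag t + (b - (tag t).+1)).+1 by rewrite -addSn subnKC.
  rewrite [X in decomposable _ X _]bE.
  exists (fun l => (y l : R) *: s (tag t) (tagged t)) => [l|].
    by apply: gradingZ; [exact: grM|exact: hy|apply: (sP _).1.1].
  by rewrite scaler_suml; apply: eq_bigr => l _; rewrite scalerA.
have a0 := (sP b).1.2 (fun i => (v ord0 (q i))@_0%MM).
have {}a0 i : (v ord0 (q i))@_0%MM = 0.
  apply: a0; rewrite (_ : \sum_i _ = - \sum_(t : T | tag t != Ordinal br)
    w ord0 (enum_rank t) *: s (tag t) (tagged t)).
    rewrite -sumrN; elim/big_ind: _ => [|x y|t /dec dt]; first exact: decomposable0.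
      exact: decomposableD.
    by rewrite -scaleN1r -[-1](@rmorphN1 _ _ (@mpolyC n K)); apply: decomposableC.
  by apply/eqP; rewrite -addr_eq0 -wsum w0.
suff [i <-] : exists i, q i = j by apply: a0.
have -> : j = enum_rank (enum_val j) by rewrite enum_valK.
rewrite /q; move: br {dec wsum wb dq q a0 wE w0 w}; rewrite /b /deg.
case: (enum_val j) => c i /= br.
case: c i br => c cr i br; have -> : br = cr by apply: bool_irrelevance.
by exists i.
Qed.

End MinimalCovers.

(** * Minimal graded free resolutions *)

Section Resolutions.
Variables (K : fieldType) (n : nat).
Local Notation R := {mpoly K[n]}.

Lemma locally_finite_rv k (deg : 'I_k -> nat) : @locally_finite K n _ (rv_homog deg).
Proof.
move=> b; pose T : finType := ('I_k * 'X_{1..n < b.+1})%type.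
pose ev (i : 'I_#|{: T}|) : T := enum_val i.
exists #|{: T}|, (fun i => 'X_[(ev i).2] *: delta_mx ord0 (ev i).1) => v hv.
exists (fun i => (v ord0 (ev i).1)@_(ev i).2).
pose F (t : T) : 'rV[R]_k := ((v ord0 t.1)@_t.2)%:MP *: ('X_[t.2] *: delta_mx ord0 t.1).
transitivity (\sum_t F t); last first.
  by rewrite (reindex ev) //=; apply/onW_bij/enum_val_bij.
rewrite -(pair_bigA _ (fun j m => F (j, m))) /= [LHS]row_sum_delta.
apply: eq_bigr => j _; rewrite /F /= {1}(@mpolywE _ _ b.+1 (v ord0 j)).
  rewrite scaler_suml; apply: eq_bigr => m _.
  by rewrite scalerA mul_mpolyC.
rewrite msizeE; apply/bigmax_leqP_seq => m mv _; have := hv j; rewrite ltnS.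
case: leqP => [db /dhomogP /(_ _ mv) /= ->|_ /eqP v0]; first exact: leq_subr.
by rewrite v0 mcoeff_msupp mcoeff0 eqxx in mv.
Qed.

Lemma mulmx_const0 k k' (w : 'rV[R]_k') (D : 'M[R]_(k', k)) :
  (forall i j, (D i j)@_0%MM = 0) -> forall j, ((w *m D) ord0 j)@_0%MM = 0.
Proof.
move=> D0 j; rewrite mxE raddf_sum big1 //= => i _.
by rewrite rmorphM /= D0 mulr0.
Qed.

(** A cover reaches the homogeneous elements of the kernel; an arbitrary element is the sum of its
    components, which lie in the kernel because the map is graded. *)
Lemma cover_kernel_exact (M : lmodType R) (hM : nat -> M -> Prop) (grM : grading hM)
    k (deg : 'I_k -> nat) (g : 'I_k -> M) k' (deg' : 'I_k' -> nat) (D : 'M[R]_(k', k)) :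
  (forall j, hM (deg j) (g j)) ->
  minimal_cover (kernel_grading (rv_homog deg) (rv_comb g)) deg' (fun i => row i D) ->
  forall v, rv_comb g v = 0 <-> exists w, v = w *m D.
Proof.
move=> hg DP v; split=> [v0|[w ->]]; last first.
  rewrite mulmx_comb [rv_comb _ w]/rv_comb linear_sum big1 // => i _.
  by rewrite linearZZ /= (cover_homog DP i).2 scaler0.
have [N vE] := rv_decomp deg v; rewrite (vE N (leqnn _)).
elim/big_ind: _ => [|x y [u ->] [w ->]|e _]; first by exists 0; rewrite mul0mx.
  by exists (u + w); rewrite mulmxDl.
have [w ->] := cover_gen DP (kernel_pihomog grM hg v0 e).
by exists w; rewrite mulmx_comb.
Qed.

(* The kernel of the last map of a partial minimal resolution. *)
Record stage := Stage {
  st_rank : nat;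
  st_deg : 'I_st_rank -> nat;
  st_ker : nat -> 'rV[R]_st_rank -> Prop;
  st_grading : grading st_ker;
  st_regular : exists r, koszul_regular st_ker r;
  st_homog : forall b v, st_ker b v -> rv_homog st_deg b v;
  st_min : forall b v, st_ker b v -> forall j, (v ord0 j)@_0%MM = 0
}.

Section CoverStage.
Variables (M : lmodType R) (hM : nat -> M -> Prop).
Hypotheses (grM : grading hM) (regM : exists r, koszul_regular hM r).
Variables (k : nat) (deg : 'I_k -> nat) (g : 'I_k -> M).
Hypothesis gP : minimal_cover hM deg g.

Lemma cover_stage_regular :
  exists r, koszul_regular (kernel_grading (rv_homog deg) (rv_comb g)) r.
Proof. by have [r reg] := regM; exists r.+1; apply: (cover_kernel_regular grM gP). Qed.

Definition cover_stage : stage :=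
  Stage (kernel_gradingP (rv_grading K n deg) (rv_comb g))
    cover_stage_regular (fun b v hv => hv.1) (fun b v hv => cover_min gP hv.2).

End CoverStage.

(** The second clause identifies the new stage with the kernel of D, from which exactness of the
    assembled resolution is read off. *)
Lemma next_stage (s : stage) : exists (t : stage) (D : 'M[R]_(st_rank t, st_rank s)),
  minimal_cover (@st_ker s) (@st_deg t) (fun i => row i D) /\
  @st_ker t = kernel_grading (rv_homog (@st_deg t)) (rv_comb (fun i => row i D)).
Proof.
have fin : locally_finite (@st_ker s).
  move=> b; have [d [e eP]] := locally_finite_rv (@st_deg s) b.
  by exists d, e => v /st_homog /eP.
have [r reg] := st_regular s.
have [k [deg [g gP]]] := exists_minimal_cover (st_grading s) fin reg.
have gE : (fun i => row i (\matrix_i g i)) = g by apply/funext => i; rewrite rowK.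
by exists (cover_stage (st_grading s) (st_regular s) gP), (\matrix_i g i); rewrite gE.
Qed.

Lemma exists_resolution (M : lmodType R) (hM : nat -> M -> Prop) r :
  grading hM -> locally_finite hM ->
  (forall x, exists N (y : nat -> M), (forall e, hM e (y e)) /\ x = \sum_(e < N) y e) ->
  koszul_regular hM r ->
  exists F : resolution_data M, minimal_graded_free_resolution hM F.
Proof.
move=> grM fin decM reg.
have [k [deg [g gP]]] := exists_minimal_cover grM fin reg.
pose s0 := cover_stage grM (ex_intro _ r reg) gP.
(* Choice turns [next_stage] into a function; its iterates from the kernel of the augmentation
   provide the free modules and differentials in all positions. *)
pose nxt s := let: exist t ht := cid (next_stage s) in existT (fun t => {D | _}) t (cid ht).
pose st a := iter a (fun s => projT1 (nxt s)) s0.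
pose D a : 'M[R]_(st_rank (st a.+1), st_rank (st a)) := projT1 (projT2 (nxt (st a))).
have DP a : minimal_cover (@st_ker (st a)) (@st_deg (st a.+1)) (fun i => row i (D a)) :=
  (projT2 (projT2 (nxt (st a)))).1.
have kerE a : @st_ker (st a.+1) =
    kernel_grading (rv_homog (@st_deg (st a.+1))) (rv_comb (fun i => row i (D a))) :=
  (projT2 (projT2 (nxt (st a)))).2.
exists (@ResolutionData K n M (fun a => st_rank (st a)) (fun a => @st_deg (st a)) D g).
split=> /=.
- exact: cover_homog gP.
- move=> a i j Dij; have := st_homog (cover_homog (DP a) i) j; rewrite mxE.
  case: leqP => [ji hD|_]; last by rewrite (negPf Dij).
  by exists (st_deg i - st_deg j)%N; rewrite ?subnKC.
- move=> x; have [N [y [hy ->]]] := decM x.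
  elim/big_ind: _ => [|u w [v ->] [v' ->]|e _]; first by exists 0; apply: (esym (linear0 (rv_comb g))).
    by exists (v + v'); apply: (esym (linearD (rv_comb g) v v')).
  by have [v ->] := cover_gen gP (hy e); exists v.
- move=> v; exact: (cover_kernel_exact grM (cover_homog gP) (DP 0%N)).
- move=> a v; rewrite mulmx_comb; 
  have DS : minimal_cover (kernel_grading (rv_homog (@st_deg (st a.+1)))
      (rv_comb (fun i => row i (D a)))) (@st_deg (st a.+2)) (fun i => row i (D a.+1)).
    by rewrite -kerE; apply: DP.
  apply: (cover_kernel_exact (rv_grading K n (@st_deg (st a))) _ DS) => j.
  exact: st_homog (cover_homog (DP a) j).
by move=> a i j; have := st_min (cover_homog (DP a) i) j; rewrite mxE.
Qed.

Section MinimalResolution.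
Variables (M : lmodType R) (hM : nat -> M -> Prop).
Hypothesis grM : grading hM.
Variable F : resolution_data M.
Hypothesis FP : minimal_graded_free_resolution hM F.

Definition res_ker a : nat -> 'rV[R]_(res_rank F a) -> Prop :=
  match a with
  | 0 => kernel_grading (rv_homog (@res_deg _ _ _ F 0)) (rv_comb (@res_aug _ _ _ F))
  | a'.+1 => kernel_grading (rv_homog (@res_deg _ _ _ F a'.+1))
               (rv_comb (fun i => row i (res_diff F a')))
  end.

Lemma res_ker_grading a : grading (@res_ker a).
Proof. by case: a => [|a]; apply: kernel_gradingP; apply: rv_grading. Qed.

Lemma res_cover0 : minimal_cover hM (@res_deg _ _ _ F 0) (@res_aug _ _ _ F).
Proof.
split; first exact: aug_homog FP.
  by move=> b x _; apply: aug_surj FP x.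
move=> v /(exact0 FP) [w ->]; apply: mulmx_const0.
exact: diff_minimal FP 0%N.
Qed.

(** Exactness at F_a makes the rows generate the kernel, and exactness at F_(a+1) places their
    relations in the image of the next differential, which is minimal. *)
Lemma res_coverS a :
  minimal_cover (@res_ker a) (@res_deg _ _ _ F a.+1) (fun i => row i (res_diff F a)).
Proof.
split.
- move=> i; have hrow : rv_homog (@res_deg _ _ _ F a) (res_deg i) (row i (res_diff F a)).
    move=> j; rewrite mxE; have [->|/(diff_homog FP) [e -> De]] := eqVneq (res_diff F a i j) 0.
      by rewrite dhomog0 if_same.
    by rewrite leq_addr addKn.
  case: a i hrow => [|a] i hrow; split=> //.
    by apply/(exact0 FP); exists (delta_mx ord0 i); rewrite rowE.
  by rewrite -mulmx_comb; apply/(exactS FP); exists (delta_mx ord0 i); rewrite rowE.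
- case: a => [|a] b v [_ v0].
    by have /(exact0 FP) [w ->] := v0; exists w; rewrite mulmx_comb.
  by move: v0; rewrite -mulmx_comb => /(exactS FP) [w ->]; exists w; rewrite mulmx_comb.
move=> v; rewrite -mulmx_comb => /(exactS FP) [w ->]; apply: mulmx_const0.
exact: diff_minimal FP a.+1.
Qed.

Lemma res_ker_regular r a : koszul_regular hM r -> koszul_regular (@res_ker a) (a.+1 + r).
Proof.
move=> reg; elim: a => [|a IH]; first exact: (cover_kernel_regular grM res_cover0).
exact: (cover_kernel_regular (res_ker_grading a) (res_coverS a)).
Qed.

Lemma res_deg_le r a (j : 'I_(res_rank F a)) : koszul_regular hM r ->
  (res_deg j <= a + r)%N.
Proof.
move=> reg; case: a j => [|a] j; first exact: (cover_deg grM res_cover0 j reg).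
exact: (cover_deg (res_ker_grading a) (res_coverS a) j (@res_ker_regular _ a reg)).
Qed.

End MinimalResolution.

Lemma betti_specP (M : lmodType R) (hM : nat -> M -> Prop) a b :
  betti hM a b = 0%N \/ betti_spec hM a b (betti hM a b).
Proof.
rewrite /betti; case: pselect => [h|_]; last by left.
by right; apply: (projT2 (cid h)).
Qed.

(** The default value of [betti] is already 0; otherwise the value counts generators in some minimal
    resolution, where [res_deg_le] applies. *)
Lemma betti_eq0 (M : lmodType R) (hM : nat -> M -> Prop) r a b :
  grading hM -> koszul_regular hM r -> (a + r < b)%N -> betti hM a b = 0%N.
Proof.
move=> grM reg ab; have [//|[F FP <-]] := betti_specP hM a b.
apply/eqP; rewrite cards_eq0; apply/eqP/setP => j; rewrite !inE.
by apply/negbTE; rewrite neq_ltn (leq_ltn_trans (res_deg_le grM FP j reg) ab).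
Qed.

(** The resolution behind [betti] is an arbitrary choice, so the generator is required in each of
    them; existence of one excludes the default value. *)
Lemma betti_neq0 (M : lmodType R) (hM : nat -> M -> Prop) a b :
  (exists F : resolution_data M, minimal_graded_free_resolution hM F) ->
  (forall F : resolution_data M, minimal_graded_free_resolution hM F ->
     exists j : 'I_(res_rank F a), res_deg j = b) ->
  betti hM a b != 0%N.
Proof.
move=> [F FP] H.
have cnt G : minimal_graded_free_resolution hM G -> generator_count G a b != 0%N.
  by move=> /H [j jb]; rewrite cards_eq0; apply/set0Pn; exists j; rewrite inE jb.
rewrite /betti; case: pselect => [h|[]]; last by exists (generator_count F a b), F.
by case: (projT2 (cid h)) => G GP <-; apply: cnt.
Qed.

End Resolutions.

(** * Stanley-Reisner rings *)

Section MonomialIdeal.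
Variables (K : fieldType) (n : nat) (D : complex_on n).
Local Notation R := {mpoly K[n]}.
Local Notation I := (SR_idealr K D).
Local Notation Q := {ideal_quot I}.
Implicit Types (p q : R) (m : 'X_{1..n}).

Definition mvars m : {set 'I_n} := [set l | (0 < m l)%N].

Lemma mset_le (S : {set 'I_n}) m : (mset S <= m)%MM = (S \subset mvars m).
Proof.
apply/mnm_lepP/subsetP => [H l lS|H l]; first by have := H l; rewrite inE msetE lS.
by rewrite msetE; case lS: (l \in S) => //; have := H l lS; rewrite inE.
Qed.

Lemma prod_mset (S : {set 'I_n}) : \prod_(l in S) 'X_l = 'X_[mset S] :> R.
Proof.
rewrite mpolyXE_id [RHS](bigID (mem S)) /= [X in _ * X]big1 ?mulr1.
  by apply: eq_bigr => l lS; rewrite msetE lS expr1.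
by move=> l /negPf lS; rewrite msetE lS expr0.
Qed.

Lemma mem_SR_ideal p : (p \in (I : {pred R})) ->
  forall m, p@_m != 0 -> mvars m \notin faces D.
Proof.
move=> /asboolP [c ->] m; apply: contraNN => mD; rewrite raddf_sum big1 // => N.
move=> /minsetp ND /=; rewrite prod_mset mcoeff_mulX ifF // mset_le.
by apply: contraNF ND => Nm; apply: face_subset mD.
Qed.

Lemma SR_idealX m : mvars m \notin faces D -> 'X_[m] \in (I : {pred R}).
Proof.
move=> mD; have [N /= Nmin Nm] := minset_exists (P := fun A => A \notin faces D) mD.
rewrite -(submK (_ : mset N <= m)%MM) ?mset_le // mpolyXD.
apply: idealMr; apply/asboolP; exists (fun N' => (N' == N)%:R).
rewrite (bigD1 N) //= eqxx mul1r prod_mset big1 ?addr0 // => N' /andP[_ /negPf ->].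
by rewrite mul0r.
Qed.

Lemma SR_idealP p : reflect (forall m, p@_m != 0 -> mvars m \notin faces D)
  (p \in (I : {pred R})).
Proof.
apply: (iffP idP) => [|H]; first exact: mem_SR_ideal.
rewrite [p]mpolyE big_seq rpred_sum // => m; rewrite mcoeff_msupp => /H mD.
by rewrite -mul_mpolyC; apply: idealMr; apply: SR_idealX.
Qed.

Definition quot_map (p : R^o) : Q := \pi p.

Lemma quot_map_is_linear : linear quot_map.
Proof. by move=> a p q; rewrite /quot_map rmorphD rmorphM. Qed.

HB.instance Definition _ :=
  GRing.isLinear.Build R R^o Q _ quot_map quot_map_is_linear.

Lemma quot_map_eq0 p : (quot_map p == 0) = (p \in (I : {pred R})).
Proof. by rewrite -[p in RHS]subr0 Quotient.idealrBE -[0 in LHS](linear0 quot_map). Qed.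

Lemma quot_mapK x : exists p : R, x = quot_map p.
Proof. by exists (repr x); rewrite /quot_map reprK. Qed.

(** Independence holds because [SR_idealP] tests a polynomial one monomial at a time, and a monomial
    of a sum of homogeneous parts comes from a single degree. *)
Lemma quot_grading : grading (@quot_homog K n I).
Proof.
split=> [d|d x y [p hp ->] [q hq ->]|d e p x hp [q hq ->]|N y hy y0 e eN].
- by exists 0; rewrite ?dhomog0 // -[LHS](linear0 quot_map).
- by exists (p - q); [apply: rpredB|exact: (esym (linearB quot_map p q))].
- by exists (p * q); [rewrite addnC dhomogM|exact: (esym (linearZ_LR quot_map p q))].
have /choice [p pP] : forall e, exists p, p \is e.-homog /\ y e = quot_map p.
  by move=> e'; have [p] := hy e'; exists p.
have pI : \sum_(e < N) p e \in (I : {pred R}).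
  rewrite -quot_map_eq0 linear_sum; apply/eqP; rewrite -[RHS]y0.
  by apply: eq_bigr => i _; rewrite (pP i).2.
rewrite (pP e).2; apply/eqP; rewrite quot_map_eq0; apply/SR_idealP => m pm.
apply: (SR_idealP _ pI); rewrite raddf_sum (bigD1 (Ordinal eN)) //= big1 ?addr0 //.
move=> i ie; apply: dhomog_nemf_coeff (pP i).1 _.
have := pm; rewrite -mcoeff_msupp => /(dhomogP _ _ _ (pP e).1) /= ->.
by rewrite eq_sym.
Qed.

Lemma quot_locally_finite : locally_finite (@quot_homog K n I).
Proof.
move=> b; pose T : finType := 'X_{1..n < b.+1}.
pose ev (i : 'I_#|{: T}|) : T := enum_val i.
exists #|{: T}|, (fun i => quot_map 'X_[ev i]) => _ [p hp ->].
exists (fun i => p@_(ev i)).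
have pb : (msize p <= b.+1)%N.
  rewrite msizeE; apply/bigmax_leqP_seq => m mp _.
  by have /= := dhomogP _ _ _ hp _ mp => ->.
rewrite {1}(mpolywE pb) -[LHS]/(quot_map _) linear_sum /= (reindex ev) /=; last first.
  by apply/onW_bij/enum_val_bij.
by apply: eq_bigr => i _; rewrite -linearZ_LR -mul_mpolyC.
Qed.

Lemma quot_decomp (x : Q) :
  exists N (y : nat -> Q), (forall e, quot_homog e (y e)) /\ x = \sum_(e < N) y e.
Proof.
have [p ->] := quot_mapK x.
exists (msize p), (fun e => quot_map (pihomog mdeg e p)); split.
  by move=> e; exists (pihomog mdeg e p) => //; apply: pihomogP.
by rewrite -linear_sum -pihomog_partitionE.
Qed.

Lemma card_mvars m : (forall l, (m l <= 1)%N) -> #|mvars m| = mdeg m.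
Proof.
move=> m1; rewrite mdegE -sum1_card big_mkcond; apply: eq_bigr => l _.
by rewrite inE; have := m1 l; case: (m l) => [|[]].
Qed.

Lemma quot_regular d : (forall F, F \in faces D -> (#|F| <= d)%N) ->
  koszul_regular (@quot_homog K n I) d.
Proof.
move=> Dd c z dc hz dz.
pose pck (m : 'X_{1..n}) := [pick l | (1 < m l)%N].
have pckP m l : pck m = Some l -> (1 < m l)%N.
  by rewrite /pck; case: pickP => // l' ml' [<-].
have pck_gt0 m l : pck m = Some l -> (0 < m l)%N by move=> /pckP /ltnW.
have /choice [p pP] : forall S, exists p : R^o, (p : R) \is c.+1.-homog /\ z S = quot_map p.
  by move=> S; have [p] := hz S; exists p.
have dp S : (kdiff p S : R) \in (I : {pred R}).
  rewrite -quot_map_eq0 -kdiff_lin -(dz S); apply/eqP; apply: eq_kdiff => T.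
  by rewrite (pP T).2.
(* The picked l has exponent at least 2 in the multidegree, of which e_S takes one, so x_l divides
   x^m. The homotopy thus preserves supports of monomials, hence also I. *)
have hdp S : (khomot pck (kdiff p) S : R) \in (I : {pred R}).
  apply/SR_idealP => m; rewrite mcoeff_khomot.
  case E: (pck _) => [l|]; last by rewrite eqxx.
  case: ifP => lS; last by rewrite eqxx.
  rewrite mulf_eq0 signr_eq0 /= => /(SR_idealP _ (dp _)).
  have := pckP _ _ E; rewrite mnmDE msetE lS addn1 ltnS => ml.
  suff -> : mvars (m + U_(l)) = mvars m by []; apply/setP => k; rewrite !inE mnmDE mnm1E.
  by case: eqP => [<-|]; rewrite ?addn0 // addn1 ml.
exists (fun S => quot_map (khomot pck p S)) => S.
  by exists (khomot pck p S) => //; apply: homog_khomot => T; apply: (pP T).1.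
rewrite kdiff_lin (pP S).2; apply/eqP; rewrite -subr_eq0 -linearB quot_map_eq0.
rewrite -[X in X \in _](addrK (khomot pck (kdiff p) S)) rpredB //.
rewrite addrAC; apply/SR_idealP => m; rewrite mcoeffB mcoeffD (khomotopy pck_gt0).
case E: (pck _) => [l|]; first by rewrite subrr eqxx.
(* When nothing is picked, m is squarefree of degree c + 1 > d, and its support is too large to be a
   face. *)
rewrite sub0r oppr_eq0 -mcoeff_msupp => /(dhomogP _ _ _ (pP S).1) /= mc.
apply: contraTN (dc) => /Dd; rewrite card_mvars ?mc -?ltnNge // => l.
move: E; rewrite /pck; case: pickP => // /(_ l) /negbT; rewrite -leqNgt => ml _.
by apply: leq_trans ml; rewrite mnmDE leq_addr.
Qed.

Definition ideal_map (x : ideal_module I) : R^o := ideal_val x.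

Lemma ideal_map_is_linear : linear ideal_map.
Proof. by []. Qed.

HB.instance Definition _ :=
  GRing.isLinear.Build R (ideal_module I) R^o _ ideal_map ideal_map_is_linear.

Lemma ideal_grading : grading (@ideal_homog K n I).
Proof.
split=> [d|d x y hx hy|d e p x hp hx|N y hy y0 e eN].
- exact: dhomog0.
- exact: (gradingB (poly_grading K n) hx hy).
- exact: (gradingZ (poly_grading K n) hp hx).
apply: val_inj.
apply: (grading_indep (poly_grading K n) (y := fun e => ideal_map (y e)) hy _ eN).
by rewrite -linear_sum y0 linear0.
Qed.

(** Dimension shifting for R -> R/I, whose kernel is I. *)
Lemma ideal_regular d : (forall F, F \in faces D -> (#|F| <= d)%N) ->
  koszul_regular (@ideal_homog K n I) d.+1.
Proof.
move=> Dd; apply: (koszul_regular_inj (f := ideal_map)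
  (hN := kernel_grading (@poly_homog K n) quot_map)).
- exact: val_inj.
- move=> b x; split=> [hx|[]] //; split=> //.
  by apply/eqP; rewrite quot_map_eq0; apply: ideal_valP.
- move=> b p [_ /eqP]; rewrite quot_map_eq0 => pI.
  by exists (IdealModule pI).
apply: (koszul_regular_kernel (hN := @quot_homog K n I) (poly_grading K n)).
- by move=> b p hp; exists p.
- by move=> b x [p hp ->]; exists p.
- exact: koszul_regularW (leq0n d) (@koszul_regular_poly K n).
exact: quot_regular.
Qed.

(* All generators of F_0 have degree 0, so an entry of the first differential has
   no face monomials; as every proper divisor of x_N is one, the entry whose
   multiple contains x_N has degree #|N|. *)
Lemma quot_first_syzygy (F : resolution_data Q) (N : {set 'I_n}) :
  minimal_graded_free_resolution (@quot_homog K n I) F -> minimal_nonface D N ->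
  exists j : 'I_(res_rank F 1), res_deg j = #|N|.
Proof.
move=> FP Nmin; have c0 := res_cover0 FP.
have deg0 (j : 'I_(res_rank F 0)) : res_deg j = 0%N.
  case E: (res_deg j) => [|c] //; have /eqP[] : res_deg j != c.+1; last by [].
  apply: (cover_deg_neq c0) => _ [p hp ->].
  have [y hy ->] := koszul_regular_generated (poly_grading K n)
    (@koszul_regular_poly K n) (leq0n c) hp.
  exists (fun l => quot_map (y l)) => [l|]; first by exists (y l) => //; apply: hy.
  rewrite -[LHS]/(quot_map _) linear_sum; apply: eq_bigr => l _.
  by rewrite linearZ_LR.
have [j0 _] : exists j : 'I_(res_rank F 0), true.
  have [v vE] := aug_surj FP 1; apply: contrapT => H.
  suff : 1 == 0 :> Q by rewrite oner_eq0.
  rewrite vE /augmentation big1 // => j; case: H; by exists j.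
have augE j : exists a : K, @res_aug _ _ _ F j = quot_map a%:MP.
  have [p hp ->] := cover_homog c0 j; rewrite deg0 in hp.
  exists p@_0%MM; congr quot_map; apply/mpolyP => m; rewrite mcoeffC.
  case: eqP => [->|/eqP m0]; rewrite ?mulr1 // mulr0.
  by apply: (dhomog_nemf_coeff hp); rewrite /= mdeg_eq0.
have /choice [a aE] := augE.
have combE (v : 'rV[R]_(res_rank F 0)) :
    rv_comb (@res_aug _ _ _ F) v = quot_map (\sum_j a j *: v ord0 j).
  rewrite linear_sum; apply: eq_bigr => j _.
  by rewrite aE -linearZ_LR -[_ *: _]/(_ * _) mulrC mul_mpolyC.
have NX : 'X_[mset N] \in (I : {pred R}).
  apply: SR_idealX; rewrite (_ : mvars _ = N) ?(minsetp Nmin) //.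
  by apply/setP => l; rewrite inE msetE; case: (l \in N).
pose u : 'rV[R]_(res_rank F 0) := 'X_[mset N] *: delta_mx ord0 j0.
(* The monomial x_N kills R/I, so x_N times any basis vector is a syzygy. *)
have [w wE] : exists w, u = w *m res_diff F 0.
  apply/(exact0 FP); rewrite -[LHS]/(rv_comb _ _) combE; apply/eqP; rewrite quot_map_eq0.
  by rewrite rpred_sum // => j _; rewrite -mul_mpolyC idealMr // !mxE mulrC idealMr.
have [i wi] : exists i, (w ord0 i * res_diff F 0 i j0)@_(mset N) != 0.
  apply: contrapT => H; have /eqP := congr1 (fun x : 'rV[R]__ => (x ord0 j0)@_(mset N)) wE.
  rewrite /= !mxE !eqxx mulr1 mcoeffX eqxx raddf_sum big1 ?oner_eq0 // => i _.
  by apply/eqP; apply: contrapT => /negP wi; apply: H; exists i.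
have [m mN Dm] : exists2 m, (m <= mset N)%MM & (res_diff F 0 i j0)@_m != 0.
  move: wi; rewrite -mcoeff_msupp => /msuppM_le /allpairsP[[m1 m] /= [_ mD ->]].
  by exists m; rewrite -?mcoeff_msupp // lem_addl.
have mE : m = mset (mvars m).
  apply/mnmP => l; have := mnm_lepP mN l; rewrite !msetE inE.
  by case: (l \in N); case: (m l) => [|[]].
(* Otherwise the coefficients at m along row i form a relation with constant entries among the
   generators, nonzero at [j0], against minimality. *)
have mND : mvars m \notin faces D.
  apply/negP => mF; have Ri := cover_homog (res_coverS FP 0) i.
  pose v : 'rV[R]_(res_rank F 0) := \row_j ((res_diff F 0 i j)@_m)%:MP.
  have v0 : rv_comb (@res_aug _ _ _ F) v = 0.
    have := Ri.2; rewrite !combE => /eqP; rewrite quot_map_eq0 => /mem_SR_ideal /(_ m) H.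
    rewrite (_ : \sum_j _ = 0) ?linear0 //.
    rewrite (_ : \sum_j _ = ((\sum_j a j *: (row i (res_diff F 0)) ord0 j)@_m)%:MP).
      case: eqP H => [-> _|_ /(_ erefl)]; [by rewrite mpolyC0|by rewrite mF].
    rewrite !raddf_sum; apply: eq_bigr => j _.
    by rewrite !mxE /= mcoeffZ -mul_mpolyC -rmorphM.
  by have := cover_min c0 v0 j0; rewrite mxE mcoeffC eqxx mulr1; apply/eqP.
have {mE mND} mE : m = mset N.
  rewrite mE; congr mset; apply: (minsetinf Nmin) => //.
  apply/subsetP => l; have := mnm_lepP mN l; rewrite msetE inE.
  by case: (l \in N) => //; case: (m l).
exists i; have [e -> De] : exists2 e, res_deg i = e & res_diff F 0 i j0 \is e.-homog.
  have [|e -> De] := diff_homog FP (i := i) (j := j0).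
    by apply: contraNneq Dm => ->; rewrite mcoeff0.
  by exists e; rewrite ?deg0.
move: Dm; rewrite -mcoeff_msupp mE => /(dhomogP _ _ _ De) /= <-.
rewrite -card_mvars => [|l]; last by rewrite msetE; case: (l \in N).
by congr #|pred_of_set _|; apply/setP => l; rewrite inE msetE; case: (l \in N).
Qed.

End MonomialIdeal.

(** * Krull dimension *)

Section PrimeChains.
Variables (A : comNzRingType) (P : {pred A}).
Hypothesis primeP : is_prime_ideal P.

Lemma prime0 : 0 \in P. Proof. by have [[]] := primeP. Qed.

Lemma prime1 : 1 \notin P. Proof. by have [[]] := primeP. Qed.

Lemma primeD x y : x \in P -> y \in P -> x + y \in P.
Proof. by have [[_ _ H] _] := primeP; move=> *; rewrite -[x]mul1r; apply: H. Qed.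

Lemma primeMl a x : x \in P -> a * x \in P.
Proof.
by have [[P0 _ H] _] := primeP; move=> *; rewrite -[_ * _]addr0; apply: H.
Qed.

Lemma primeB x y : x \in P -> y \in P -> x - y \in P.
Proof. by move=> Px Py; rewrite -mulN1r primeD // primeMl. Qed.

Lemma prime_sum (I : Type) (s : seq I) (C : pred I) (F : I -> A) :
  (forall i, C i -> F i \in P) -> \sum_(i <- s | C i) F i \in P.
Proof. by move=> H; elim/big_ind: _ => //; [apply: prime0|apply: primeD]. Qed.

Lemma prime_prod (I : eqType) (s : seq I) (C : pred I) (F : I -> A) :
  \prod_(i <- s | C i) F i \in P -> exists2 i, C i & F i \in P.
Proof.
elim/big_rec: _ => [/(negP prime1)//|i x Ci IH /(primeP.2) /orP[Fi|/IH //]].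
by exists i.
Qed.

Lemma prime_expr x j : x ^+ j \in P -> x \in P.
Proof.
elim: j => [/(negP prime1)//|j IH]; rewrite exprS => /(primeP.2) /orP[//|/IH //].
Qed.

End PrimeChains.

(* Among the exponents of a relation, those minimal in the coordinates < k give
   a relation modulo P k; for k = L a single invertible coefficient is left. *)
Lemma prime_chain_independent (A : comNzRingType) (L : nat) (P : nat -> {pred A})
    (g : 'I_L -> A) (N : nat) (c : {ffun 'I_L -> 'I_N} -> A) :
  prime_chain L P -> (forall k : 'I_L, g k \in P k.+1 /\ g k \notin P k) ->
  (forall e, c e = 0 \/ exists b, b * c e = 1) ->
  \sum_e c e * \prod_k g k ^+ e k \in P 0%N -> forall e, c e = 0.
Proof.
move=> [primeP chainP] gP cP rel e0; apply/eqP/contraT => ce0.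
pose t k e := c e * \prod_(i < L | (k <= i)%N) g i ^+ e i.
have step k : (k <= L)%N -> exists E : {set {ffun 'I_L -> 'I_N}},
    [/\ E != set0, forall e, e \in E -> c e != 0,
     forall e e' (i : 'I_L), e \in E -> e' \in E -> (i < k)%N -> e i = e' i &
     \sum_(e in E) t k e \in P k].
  elim: k => [_|k IH kL].
    exists [set e | c e != 0]; split=> //; first by apply/set0Pn; exists e0; rewrite inE.
      by move=> e; rewrite inE.
    rewrite (_ : \sum_(e in _) _ = \sum_e c e * \prod_k g k ^+ e k) //.
    rewrite big_mkcond /=; apply: eq_bigr => e _; rewrite inE.
    by case: eqP => [->|//]; rewrite mul0r.
  have [E [/set0Pn [e1 e1E] cE eqE sE]] := IH (ltnW kL).
  pose ko := Ordinal kL; have [gk1 gk] := gP ko.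
  have [em emE em_min] := arg_minnP (fun e : {ffun 'I_L -> 'I_N} => e ko : nat) e1E.
  have {}emE : em \in E := emE.
  pose E' := [set e in E | e ko == em ko].
  have Pk := primeP k (ltnW kL); have Pk1 := primeP k.+1 kL.
  have tE e : e \in E -> t k e = g ko ^+ em ko * (g ko ^+ (e ko - em ko) * t k.+1 e).
    move=> eE; rewrite mulrA -exprD subnKC ?em_min // /t (bigD1 ko) //=.
    rewrite mulrCA; congr (_ * (_ * _)); apply: eq_bigl => i.
    by rewrite -(inj_eq val_inj) /= ltn_neqAle eq_sym andbC.
  exists E'; split.
  - by apply/set0Pn; exists em; rewrite inE emE eqxx.
  - by move=> e; rewrite inE => /andP[/cE].
  - move=> e e' i; rewrite !inE => /andP[eE /eqP ek] /andP[e'E /eqP ek'].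
    rewrite ltnS leq_eqVlt => /orP[/eqP ik|]; last exact: eqE.
    by rewrite (_ : i = ko) ?ek //; apply: val_inj.
  (* The least power of [g ko] divides every term and is not in P k, so it cancels. The terms with a
     larger exponent keep a factor [g ko], which is in P k.+1, and drop out there. *)
  have : \sum_(e in E) g ko ^+ (e ko - em ko) * t k.+1 e \in P k.
    move: sE; rewrite (eq_bigr _ tE) -mulr_sumr => /(Pk.2) /orP[|//].
    by move=> /(prime_expr Pk); rewrite (negPf gk).
  move=> /((chainP k kL).1) {}sE.
  rewrite (bigID (mem E')) /= in sE.
  rewrite -(_ : \sum_(e in E | e \in E') g ko ^+ (e ko - em ko) * t k.+1 e = \sum_(e in E') _).
    rewrite -[X in X \in _](addrK (\sum_(e in E | e \notin E') g ko ^+ (e ko - em ko) * t k.+1 e)).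
    apply: (primeB Pk1) => //; apply: (prime_sum Pk1) => e /andP[eE].
    rewrite inE eE /= => ek; rewrite mulrC; apply: (primeMl Pk1).
    have : (0 < e ko - em ko)%N by rewrite subn_gt0 ltn_neqAle em_min // eq_sym ek.
    by case: (_ - _)%N => // j _; rewrite exprSr; apply: (primeMl Pk1).
  apply: eq_big => [e|e /andP[_]]; first by rewrite inE; case: (e \in E).
  by rewrite inE => /andP[_ /eqP ->]; rewrite subnn expr0 mul1r.
have [E [/set0Pn [e1 e1E] cE eqE]] := step L (leqnn L).
have PL := primeP L (leqnn L).
have E1 e : (e \in E) = (e == e1).
  apply/idP/eqP => [eE|-> //]; apply/ffunP => i; exact: eqE.
rewrite (big_pred1 e1) // /t big_pred0 ?mulr1 => [|i]; last by rewrite leqNgt ltn_ord.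
have := cE _ e1E; have [->|[b bc] _] := cP e1; first by rewrite eqxx.
by move=> /(primeMl PL b); rewrite bc (negPf (prime1 PL)).
Qed.

(** * Restriction to a set of variables and algebraic dependence *)

Section Restriction.
Variables (K : fieldType) (n : nat).
Local Notation R := {mpoly K[n]}.
Implicit Types (p q : R) (m : 'X_{1..n}) (S : {set 'I_n}).

Definition vrestr S : R -> R :=
  comp_mpoly [tuple if l \in S then 'X_l else 0 | l < n].

HB.instance Definition _ S := GRing.RMorphism.on (vrestr S).

Lemma vrestrX S m : vrestr S 'X_[m] = if mvars m \subset S then 'X_[m] else 0.
Proof.
rewrite /vrestr comp_mpolyX; case: ifP => [/subsetP mS|/negbT /subsetPn [l]].
  rewrite mpolyXE_id; apply: eq_bigr => l _; rewrite tnth_mktuple.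
  case: ifP => // lS; have := mS l; rewrite inE lS.
  by case: (m l) => // j /(_ isT).
rewrite inE => ml lS; rewrite (bigD1 l) //= tnth_mktuple (negPf lS).
by rewrite expr0n eqn0Ngt ml mul0r.
Qed.

Lemma mcoeff_vrestr S p m :
  (vrestr S p)@_m = if mvars m \subset S then p@_m else 0.
Proof.
have -> : vrestr S p = \sum_(m' <- msupp p) p@_m' *: vrestr S 'X_[m'].
  rewrite {1}[p]mpolyE raddf_sum; apply: eq_bigr => m' _.
  by rewrite [LHS]comp_mpolyZ.
rewrite raddf_sum -[RHS](@sum_msupp_delta _ _ p m) => [|->]; last exact: if_same.
apply: eq_bigr => m' _ /=; rewrite mcoeffZ vrestrX.
have [->|/negPf m'm] := eqVneq m' m.
  by case: ifP => _; rewrite ?mcoeffX ?mcoeff0 ?eqxx ?mulr1 ?mulr0.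
by case: ifP => _; rewrite ?mcoeffX ?mcoeff0 ?m'm mulr0.
Qed.

Lemma vrestr_id S p : vrestr S (vrestr S p) = vrestr S p.
Proof. by apply/mpolyP => m; rewrite !mcoeff_vrestr; case: (_ \subset _). Qed.

Definition deg_le b p := forall m, p@_m != 0 -> (mdeg m <= b)%N.

Lemma deg_le1 : deg_le 0 1.
Proof. by move=> m; rewrite mcoeff1; have [->|] := eqVneq m 0%MM; rewrite ?mdeg0 ?eqxx. Qed.

Lemma deg_leM b c p q : deg_le b p -> deg_le c q -> deg_le (b + c) (p * q).
Proof.
move=> hp hq m; rewrite -mcoeff_msupp => /msuppM_le /allpairsP[[m1 m2] /= [m1p m2q ->]].
by rewrite mdegD leq_add ?hp ?hq // -mcoeff_msupp.
Qed.

Lemma deg_leX b p j : deg_le b p -> deg_le (j * b) (p ^+ j).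
Proof.
move=> hp; elim: j => [|j IH]; first exact: deg_le1.
by rewrite exprS mulSn; apply: deg_leM.
Qed.

Lemma deg_leW b c p : (b <= c)%N -> deg_le b p -> deg_le c p.
Proof. by move=> bc hp m /hp mb; apply: leq_trans bc. Qed.

Lemma deg_le_prod (I : Type) (s : seq I) b (F : I -> R) :
  (forall i, deg_le b (F i)) -> deg_le (size s * b) (\prod_(i <- s) F i).
Proof.
move=> hF; elim: s => [|i s IH]; first by rewrite big_nil; apply: deg_le1.
by rewrite big_cons mulSn; apply: deg_leM.
Qed.

(* Dimension count: there are N^L monomials of exponent < N in the p_k, which
   lie in a space of dimension O(N^#|S|). *)
Lemma algebraic_dependence S L (p : 'I_L -> R) : (#|S| < L)%N ->
  (forall k, vrestr S (p k) = p k) ->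
  exists N (u : {ffun 'I_L -> 'I_N} -> K), (exists e, u e != 0) /\
    \sum_e u e *: \prod_k p k ^+ e k = 0.
Proof.
move=> SL pS.
have [B hB] : exists B, forall k, deg_le B (p k).
  exists (\max_k msize (p k)) => k m; rewrite -mcoeff_msupp => /msize_mdeg_lt mp.
  by apply: leq_trans (ltnW mp) _; apply: (leq_bigmax k).
(* With s = #|S|, the products have degree at most L N B < C <= N G. So C^s <= N^s G^s < N^(s+1) <=
   N^L: fewer available monomials than products. *)
pose G := (L * B).+1; pose N := (G ^ #|S|).+1; pose C := (L * (N * B)).+1.
exists N; pose E := {ffun 'I_L -> 'I_N}; pose T := {ffun 'I_#|S| -> 'I_C}.
pose q (e : E) : R := \prod_k p k ^+ e k.
have qS e : vrestr S (q e) = q e.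
  by rewrite rmorph_prod; apply: eq_bigr => k _; rewrite rmorphXn /= pS.
have qdeg e : deg_le (L * (N * B)) (q e).
  have := @deg_le_prod _ (index_enum 'I_L) (N * B) (fun k => p k ^+ e k).
  rewrite -[size _]/(size (index_enum 'I_L)) [size _](_ : _ = L); last first.
    by rewrite /index_enum -enumT size_enum_ord.
  apply=> k; apply: (@deg_leW (e k * B)); last exact: deg_leX.
  by rewrite leq_mul2r (ltnW (ltn_ord _)) orbT.
pose mon (f : T) : 'X_{1..n} :=
  [multinom (\sum_(j | enum_val j == l) f j)%N | l < n].
have TE : (#|{: T}| < #|{: E}|)%N.
  rewrite !card_ffun !card_ord.
  have CG : (C <= N * G)%N.
    rewrite /C /G mulnS mulnCA addnC -addn1 leq_add2l //.
  apply: leq_ltn_trans (_ : (N * G) ^ #|S| < _)%N; first by case: #|S| => // s; rewrite leq_exp2r.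
  rewrite expnMn; apply: leq_trans (_ : N ^ #|S|.+1 <= _)%N; last by rewrite leq_pexp2l.
  by rewrite expnSr ltn_pmul2l // expn_gt0.
have [v v0 vA] := left_kernel
  (\matrix_(i < #|{: E}|, j < #|{: T}|) (q (enum_val i))@_(mon (enum_val j))) TE.
pose u (e : E) := v ord0 (enum_rank e); exists u; split.
  have /rV0Pn [i vi] := v0.
  by exists (enum_val i); rewrite /u enum_valK.
apply/mpolyP => m; rewrite mcoeff0 raddf_sum /=.
have [/andP[mS /forallP mC]|] := boolP ((mvars m \subset S) && [forall l, m l < C]%N); last first.
  move=> H; rewrite big1 // => e _; rewrite mcoeffZ -[\prod_k _]/(q e) -qS mcoeff_vrestr.
  case: ifP => mS; last by rewrite mulr0.
  apply/eqP; rewrite mulf_eq0; apply/orP; right; apply: contraR H => qm.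
  rewrite mS; apply/forallP => l; rewrite ltnS; apply: leq_trans (qdeg _ _ qm).
  by rewrite mdegE (bigD1 l) //= leq_addr.
pose f : T := [ffun j => Ordinal (mC (enum_val j))].
have fm : mon f = m.
  apply/mnmP => l; rewrite mnmE.
  have [lS|lS] := boolP (l \in S).
    rewrite (big_pred1 (enum_rank_in lS l)) ?ffunE /= ?enum_rankK_in // => j.
    by apply/eqP/eqP => [jl|->]; [apply: enum_val_inj|]; rewrite enum_rankK_in.
  rewrite big_pred0 => [|j]; last first.
    by apply: contraNF lS => /eqP <-; apply: enum_valP.
  by move/subsetP: mS => /(_ l); rewrite inE (negPf lS); case: (m l) => // j /(_ isT).
transitivity ((v *m (\matrix_(i < #|{: E}|, j < #|{: T}|)
    (q (enum_val i))@_(mon (enum_val j)))) ord0 (enum_rank f)); last by rewrite vA mxE.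
rewrite mxE [RHS](reindex (@enum_rank E)) /=; last exact/onW_bij/enum_rank_bij.
by apply: eq_bigr => e _; rewrite !mxE !enum_rankK fm mcoeffZ.
Qed.

End Restriction.

(** * Prime ideals of a Stanley-Reisner ring *)

Section StanleyReisnerDimension.
Variables (K : fieldType) (n : nat) (D : complex_on n).
Local Notation R := {mpoly K[n]}.
Local Notation I := (SR_idealr K D).
Local Notation Q := (stanley_reisner_ring K D).
Implicit Types (p q : R) (S T : {set 'I_n}).

Definition SR_class (p : R) : Q := \pi p.

Lemma SR_classB p q : SR_class (p - q) = SR_class p - SR_class q.
Proof. exact: (rmorphB (\pi_{ideal_quot I} : {rmorphism R -> {ideal_quot I}})). Qed.

Lemma SR_class1 : SR_class 1 = 1.
Proof. exact: (rmorph1 (\pi_{ideal_quot I} : {rmorphism R -> {ideal_quot I}})). Qed.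

Lemma SR_classM p q : SR_class (p * q) = SR_class p * SR_class q.
Proof. exact: (rmorphM (\pi_{ideal_quot I} : {rmorphism R -> {ideal_quot I}})). Qed.

HB.instance Definition _ :=
  GRing.isZmodMorphism.Build R Q SR_class SR_classB.
HB.instance Definition _ :=
  GRing.isMonoidMorphism.Build R Q SR_class (SR_class1, SR_classM).

Lemma SR_class_eq0 p : (SR_class p == 0) = (p \in (I : {pred R})).
Proof. exact: quot_map_eq0. Qed.

Lemma SR_classK (x : Q) : SR_class (repr x) = x.
Proof. exact: reprK. Qed.

Lemma vrestr_SR_ideal S p : S \in faces D -> p \in (I : {pred R}) -> vrestr S p = 0.
Proof.
move=> SD pI; apply/mpolyP => m; rewrite mcoeff_vrestr mcoeff0.
case: ifP => // mS; apply/eqP; apply: contraT => /(mem_SR_ideal pI) /negP[].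
exact: face_subset SD.
Qed.

(** The kernel of the projection to the polynomial ring in the variables of S, tested on one
    representative; for a face S, [face_primeE] shows that the representative does not matter. *)
Definition face_prime S : {pred Q} := fun x => vrestr S (repr x) == 0.

Lemma face_primeE S p : S \in faces D -> (SR_class p \in face_prime S) = (vrestr S p == 0).
Proof.
move=> SD; rewrite -topredE /= /face_prime -[in RHS](subrK (repr (SR_class p)) p).
rewrite rmorphD /= [vrestr S (p - _)](vrestr_SR_ideal SD) ?add0r //.
by rewrite -SR_class_eq0 rmorphB /= SR_classK subrr.
Qed.

Lemma face_primeP S : S \in faces D -> is_prime_ideal (face_prime S).
Proof.
move=> SD; split; first split.
- by rewrite -(rmorph0 SR_class) face_primeE // rmorph0.
- by rewrite -(rmorph1 SR_class) face_primeE // rmorph1 oner_eq0.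
- move=> a x y; rewrite -[a]SR_classK -[x]SR_classK -[y]SR_classK.
  rewrite -rmorphM -rmorphD !face_primeE // rmorphD rmorphM /=.
  by move=> /eqP -> /eqP ->; rewrite mulr0 addr0.
move=> x y; rewrite -[x]SR_classK -[y]SR_classK -rmorphM !face_primeE // rmorphM.
by rewrite mulf_eq0.
Qed.

Lemma face_prime_sub S T : S \in faces D -> T \subset S ->
  {subset face_prime S <= face_prime T}.
Proof.
move=> SD TS x; have TD := face_subset TS SD.
rewrite -[x]SR_classK !face_primeE // => /eqP x0; apply/eqP/mpolyP => m.
rewrite mcoeff_vrestr mcoeff0; case: ifP => // mT.
have := congr1 (mcoeff m) x0; rewrite mcoeff_vrestr mcoeff0.
by rewrite (subset_trans mT TS).
Qed.

(** Deleting the vertices of S one by one enlarges the prime, strictly so by the variable of the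
    deleted vertex. *)
Lemma face_prime_chain S : S \in faces D ->
  exists P : nat -> {pred Q}, prime_chain #|S| P.
Proof.
move=> SD; pose F k := [set l in take (#|S| - k) (enum S)].
have FS k : F k \subset S.
  by apply/subsetP => l; rewrite inE => /mem_take; rewrite mem_enum.
have FD k : F k \in faces D by apply: face_subset SD.
exists (fun k => face_prime (F k)); split=> [k _|k kS]; first exact: face_primeP.
split.
  apply: face_prime_sub => //; apply/subsetP => l; rewrite !inE.
  by rewrite -(@take_takel _ (#|S| - k.+1) (#|S| - k)) ?leq_sub2l // => /mem_take.
have [l0 _] : exists l, l \in S by apply/set0Pn; rewrite -card_gt0 (leq_ltn_trans _ kS).
pose s := enum S; pose a := (#|S| - k.+1)%N; pose l := nth l0 s a.
have sz : (a < size s)%N by rewrite -cardE ltn_subrL (leq_ltn_trans _ kS).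
have takeS : take (#|S| - k) s = rcons (take a s) l by rewrite -take_nth // /a subnSK.
have mvarsU : mvars U_(l) = [set l].
  by apply/setP => j; rewrite !inE mnm1E eq_sym; case: eqP.
exists (SR_class 'X_l); rewrite !face_primeE // !vrestrX mvarsU !sub1set !inE takeS.
rewrite mem_rcons inE eqxx /= ifF ?eqxx.
  by split=> //; rewrite -msize_poly_eq0 msizeX.
apply: contraTF (take_uniq (#|S| - k) (enum_uniq S)) => lt.
by rewrite takeS rcons_uniq lt.
Qed.

(** S collects the variables outside P. Their product is not in P, so it is nonzero and S is a face;
    the other variables vanish modulo P. *)
Lemma prime_contains_face_prime (P : {pred Q}) : is_prime_ideal P ->
  exists2 S, S \in faces D & forall p, SR_class (p - vrestr S p) \in P.
Proof.
move=> primeP; pose S := [set l : 'I_n | SR_class 'X_l \notin P].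
exists S.
  apply: contraT => SD.
  have : SR_class 'X_[mset S] \in P.
    suff /eqP -> : SR_class 'X_[mset S] == 0 by apply: prime0.
    rewrite SR_class_eq0 SR_idealX // (_ : mvars _ = S) //.
    by apply/setP => l; rewrite inE msetE; case: (l \in S).
  rewrite -prod_mset rmorph_prod => /(prime_prod primeP) [l].
  by rewrite inE => /negP.
have PX m : SR_class ('X_[m] - vrestr S 'X_[m]) \in P.
  rewrite vrestrX; case: ifP => [_|/negbT/subsetPn [l]].
    by rewrite subrr rmorph0; apply: prime0.
  rewrite !inE negbK subr0 => ml lP.
  rewrite -(@submK _ U_(l)%MM m) ?lep1mP -?lt0n // mpolyXD rmorphM.
  exact: primeMl.
move=> p; rewrite (_ : p - _ = \sum_(m <- msupp p) (p@_m)%:MP * ('X_[m] - vrestr S 'X_[m])).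
  by rewrite rmorph_sum; apply: prime_sum => // m _; rewrite rmorphM; apply: primeMl.
rewrite {1 2}[p]mpolyE [vrestr S (\sum_(_ <- _) _)]raddf_sum -sumrB; apply: eq_bigr => m _ /=.
by rewrite mulrBr -!mul_mpolyC rmorphM /= [vrestr S _%:MP]comp_mpolyC.
Qed.

Lemma prime_chain_le d l (P : nat -> {pred Q}) :
  (forall F, F \in faces D -> (#|F| <= d)%N) -> prime_chain l P -> (l <= d)%N.
Proof.
move=> Dd [primeP chainP]; rewrite leqNgt; apply/negP => dl; pose L := d.+1.
have primeL : prime_chain L P.
  split=> k kL; first by apply: primeP; apply: leq_trans dl.
  by apply: chainP; apply: leq_trans dl.
have [S SD PS] := prime_contains_face_prime (primeP 0%N (leq0n _)).
have chain0 k x : (k <= L)%N -> x \in P 0%N -> x \in P k.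
  elim: k => // k IH kL x0; apply: ((primeL.2 k kL).1); exact: IH (ltnW kL) x0.
(* Restricting a representative to S changes its class by an element of P 0, which lies in every P
   k, so the restriction still separates P k from P k.+1. *)
have /choice [f fP] : forall k : 'I_L, exists p,
    [/\ vrestr S p = p, SR_class p \in P k.+1 & SR_class p \notin P k].
  move=> k; have [_ [x [xk1 xk]]] := primeL.2 k (ltn_ord k).
  exists (vrestr S (repr x)); rewrite vrestr_id.
  have := PS (repr x); rewrite rmorphB /= SR_classK => x0.
  have xE : SR_class (vrestr S (repr x)) = x - (x - SR_class (vrestr S (repr x))).
    by rewrite opprB addrC subrK.
  split=> //.
    by rewrite xE (primeB (primeL.1 k.+1 _)) // chain0.
  apply: contra xk => fk; rewrite -[x](subrK (SR_class (vrestr S (repr x)))).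
  apply: (primeD (primeL.1 k (ltnW (ltn_ord k))) _ fk).
  exact: (chain0 _ _ (ltnW (ltn_ord k)) x0).
have [N [u [[e ue] usum]]] := algebraic_dependence (leq_ltn_trans (Dd _ SD) (ltnSn d))
  (fun k => let: And3 H _ _ := fP k in H).
have /(_ e) : forall e, SR_class (u e)%:MP = 0.
  apply: (prime_chain_independent (g := fun k => SR_class (f k)) primeL).
  - by move=> k; have [] := fP k.
  - move=> e'; have [->|ue'] := eqVneq (u e') 0; first by left; rewrite !rmorph0.
    by right; exists (SR_class (u e')^-1%:MP); rewrite -!rmorphM mulVf // !rmorph1.
  rewrite (_ : \sum_e _ = SR_class (\sum_e u e *: \prod_k f k ^+ e k)).
    by rewrite usum rmorph0; apply: prime0 (primeL.1 0%N _).
  rewrite rmorph_sum; apply: eq_bigr => e' _ /=; rewrite -mul_mpolyC rmorphM /=.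
  by rewrite rmorph_prod; congr (_ * _); apply: eq_bigr => k _; rewrite rmorphXn.
move=> /eqP; rewrite SR_class_eq0 => /mem_SR_ideal /(_ 0%MM).
rewrite mcoeffC eqxx mulr1 => /(_ ue) /negP[].
by rewrite (_ : mvars _ = set0) ?face0 //; apply/setP => l'; rewrite !inE mnm0E.
Qed.

Lemma SR_krull_dim d : (forall F, F \in faces D -> (#|F| <= d)%N) ->
  (exists2 F, F \in faces D & #|F| = d) -> is_krull_dim Q d.
Proof.
move=> Dd [F FD Fd]; split; last by move=> l P; apply: prime_chain_le.
by have [P PP] := face_prime_chain FD; exists P; rewrite -Fd.
Qed.

End StanleyReisnerDimension.

Lemma subset_of_card (T : finType) (A : {set T}) k : (k <= #|A|)%N ->
  exists2 B : {set T}, B \subset A & #|B| = k.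
Proof.
move=> /card_geqP [s [us <- sA]]; exists [set x in s].
  by apply/subsetP => x; rewrite inE; apply: sA.
by rewrite cardsE; apply/card_uniqP.
Qed.

Lemma mvars_mset n (S : {set 'I_n}) : mvars (mset S) = S.
Proof. by apply/setP => l; rewrite inE msetE; case: (l \in S). Qed.

Lemma mdeg_mset n (S : {set 'I_n}) : mdeg (mset S) = #|S|.
Proof. by rewrite -card_mvars ?mvars_mset // => l; rewrite msetE; case: (l \in S). Qed.

Lemma SR_idealXE (K : fieldType) n (D : complex_on n) m :
  ('X_[m] \in (SR_idealr K D : {pred _})) = (mvars m \notin faces D).
Proof.
apply/idP/idP => [/mem_SR_ideal /(_ m)|]; last exact: SR_idealX.
by rewrite mcoeffX eqxx oner_eq0; apply.
Qed.

Lemma SR_minimal_generator (K : fieldType) n (D : complex_on n) m :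
  minimal_monomial_generator (SR_idealr K D) m <->
  exists2 N, minimal_nonface D N & m = mset N.
Proof.
split=> [[mI mmin]|[N Nmin ->]].
  rewrite SR_idealXE in mI.
  have [N Nmin Nm] := minset_exists (P := fun A => A \notin faces D) mI.
  exists N => //; apply/esym/mmin; rewrite ?mset_le // SR_idealXE mvars_mset.
  exact: minsetp Nmin.
split=> [|m' m'N]; first by rewrite SR_idealXE mvars_mset (minsetp Nmin).
rewrite SR_idealXE => m'D.
have m'E : m' = mset (mvars m').
  apply/mnmP => l; have := mnm_lepP m'N l; rewrite !msetE inE.
  by case: (l \in N); case: (m' l) => [|[]].
rewrite m'E; congr mset; apply: (minsetinf Nmin) => //.
apply/subsetP => l; have := mnm_lepP m'N l; rewrite msetE inE.
by case: (l \in N) => //; case: (m' l).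
Qed.

(** * Skeleta *)

Section Skeleton.
Variables (n : nat) (Delta : simplicial_complex n) (i : int).
Variables (hi : -1 <= i) (hdim : i < complex_dim Delta).

(** As i >= -1, the absolute value is i + 1 itself: the size of the largest faces of the skeleton,
    and so the Krull dimension. *)
Definition skeleton_dim : nat := `|(i + 1)%R|%N.
Local Notation d := skeleton_dim.

Lemma face_dim_le (F : {set 'I_n}) : (face_dim F <= i) = (#|F| <= d)%N.
Proof.
rewrite /face_dim lerBlDr -lez_nat /d gez0_abs //.
by move: hi; rewrite -(lerD2r 1) addNr.
Qed.

Lemma mem_skeleton (F : {set 'I_n}) :
  (F \in faces (skeleton Delta hi)) = (F \in faces Delta) && (#|F| <= d)%N.
Proof. by rewrite inE face_dim_le. Qed.

Lemma exists_large_face k : (k <= d.+1)%N -> exists2 F, F \in faces Delta & #|F| = k.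
Proof.
move=> kd; have [F FD dF] : exists2 F, F \in faces Delta & (d < #|F|)%N.
  apply: contrapT => H; move: hdim; rewrite ltNge => /negP[].
  (* If all faces had at most d vertices, the maximum would be at most i, its default -1 being
     covered by [hi]. *)
  rewrite /complex_dim; elim/big_ind: _ => // [x y xi yi|F FD].
    by rewrite ge_max xi.
  by rewrite face_dim_le leqNgt; apply/negP => dF; apply: H; exists F.
have [G GF Gk] := subset_of_card (leq_trans kd dF).
by exists G => //; apply: face_subset FD.
Qed.

Lemma skeleton_card F : F \in faces (skeleton Delta hi) -> (#|F| <= d)%N.
Proof. by rewrite mem_skeleton => /andP[]. Qed.

(** Any d + 1 vertices already form a non-face, so a larger non-face is not minimal. *)
Lemma skeleton_nonface_le N : minimal_nonface (skeleton Delta hi) N -> (#|N| <= d.+1)%N.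
Proof.
move=> Nmin; rewrite leqNgt; apply/negP => dN.
have [B BN Bd] := subset_of_card (ltnW dN).
have BE : B = N.
  by apply: (minsetinf Nmin) => //; rewrite mem_skeleton Bd ltnn andbF.
by rewrite -BE Bd ltnn in dN.
Qed.

Lemma skeleton_nonface : exists2 N, minimal_nonface (skeleton Delta hi) N & #|N| = d.+1.
Proof.
have [N ND Nd] := exists_large_face (leqnn _); exists N => //.
apply/minsetP; split; first by rewrite mem_skeleton Nd ltnn andbF.
move=> B; rewrite mem_skeleton => BD BN; apply/eqP; rewrite eqEcard BN Nd /=.
by move: BD; rewrite (face_subset BN ND) /= -ltnNge.
Qed.

End Skeleton.

Unset Implicit Arguments.

Theorem corollary3p7 (n : nat) (hn : (0 < n)%N) (K : fieldType)
  (Delta : simplicial_complex n) (i : int)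
  (hi : -1 <= i) (hdim : i < complex_dim Delta) :
  has_degree_resolution (SR_idealr K (skeleton Delta hi)) /\
  exists d : nat,
    is_regularity (@quot_homog K n (SR_idealr K (skeleton Delta hi))) d%:Z /\
    is_krull_dim (stanley_reisner_ring K (skeleton Delta hi)) d.
Proof.
pose d := skeleton_dim i.
have cardD F : F \in faces (skeleton Delta hi) -> (#|F| <= d)%N by apply: skeleton_card.
have [N Nmin Nd] := skeleton_nonface hi hdim.
split.
  exists d.+1; last by move=> a b; apply: betti_eq0; [apply: ideal_grading|apply: ideal_regular].
  split.
    by exists (mset N); rewrite ?mdeg_mset //; apply/SR_minimal_generator; exists N.
  move=> m /SR_minimal_generator [N' N'min ->]; rewrite mdeg_mset.
  exact: skeleton_nonface_le N'min.
have quotR := quot_regular (K := K) cardD.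
exists d; split; last first.
  apply: SR_krull_dim => //; have [F FD Fd] := exists_large_face hi hdim (leqnSn d).
  by exists F => //; rewrite mem_skeleton // FD Fd leqnn.
split.
  (* The bound d is attained in position 1 by the first syzygy of degree d + 1 that [N] produces. *)
  exists 1%N, d.+1; split; last by rewrite -addn1 PoszD addrK.
  apply: betti_neq0; last by move=> F FP; rewrite -Nd; apply: quot_first_syzygy FP Nmin.
  exact: (exists_resolution (quot_grading _ _) (quot_locally_finite _ _) (@quot_decomp _ _ _) quotR).
move=> a b; apply: contraR; rewrite -ltNge => dab; apply/eqP.
apply: (betti_eq0 (quot_grading _ _) quotR).
by rewrite -ltz_nat PoszD -ltrBrDl.
Qed.
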